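(* Let $R$ be a real closed field and $A=R[x_1,\ldots,x_n]$ a polynomial ring. Let $q,u$ be positive integers and let $\omega_{ij},\theta_{il}\in\mathbb{Q}$ for $i\in\{1,\ldots,n\}$, $j\in\{1,\ldots,q\}$, $l\in\{1,\ldots,u\}$. Then the set $$S=\Big\{\delta\in\mathrm{Sper}(A)\ \Big|\ x_i>_\delta 0\ (1\le i\le n),\ \ \sum_{i=1}^n\omega_{ij}\nu_\delta(x_i)>0\ (1\le j\le q),\ \ \sum_{i=1}^n\theta_{il}\nu_\delta(x_i)=0\ (1\le l\le u)\Big\}$$ is connected in the spectral topology of $\mathrm{Sper}(A)$.
   Context: For a commutative ring $B$ with $1$, $\mathrm{Sper}\,B$ is the set of pairs $\alpha=(\mathfrak p_\alpha,\le_\alpha)$ with $\mathfrak p_\alpha$ a prime ideal of $B$ and $\le_\alpha$ a total (ring) ordering of $B/\mathfrak p_\alpha$. For $f\in B$, $f(\alpha)$ is its image in $B[\alpha]:=B/\mathfrak p_\alpha$, and $f>_\alpha0$ means $f(\alpha)>_\alpha0$. The spectral topology has basic open sets $U(f_1,\dots,f_k)=\{\alpha: f_1(\alpha)>0,\dots,f_k(\alpha)>0\}$. A set is connected if it is not a disjoint union of two non-empty relatively open subsets (the empty set counts as connected). The valuation $\nu_\alpha$ associated to $\alpha$: let $B(\alpha)=\mathrm{Frac}(B/\mathfrak p_\alpha)$ with the induced ordering; $R_\alpha=\{x\in B(\alpha): |x|\le_\alpha z \text{ for some } z\in B[\alpha]\}$ is a valuation ring, and $\nu_\alpha$ is the corresponding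 valuation with (additively written) value group $\Gamma_\alpha=(B(\alpha)\setminus\{0\})/U(R_\alpha)$, where $U(R_\alpha)$ is the group of units of $R_\alpha$ (so $\nu_\alpha(x)\ge0$ iff $x\in R_\alpha$). For $f\in B$, $\nu_\alpha(f)$ means $\nu_\alpha(f\bmod\mathfrak p_\alpha)$, with $\nu_\alpha(0)=\infty$. Here $B=A$, and rational linear combinations of values are taken in $\Gamma_\delta\otimes_{\mathbb Z}\mathbb Q$ with its induced order. *)

(* Defs.v *)
From HB Require Import structures.
From mathcomp Require Import all_boot all_order all_algebra.
From mathcomp Require Import generic_quotient ring_quotient fraction.
From mathcomp Require Import freeg mpoly.
From mathcomp Require Import boolp classical_sets topology_structure connected.

Set Implicit Arguments.
Unset Strict Implicit.
Unset Printing Implicit Defensive.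

Import Order.TTheory GRing.Theory Num.Theory.

Local Open Scope ring_scope.
Local Open Scope quotient_scope.
Local Open Scope classical_set_scope.

Notation "x %:F" := (@FracField.tofrac _ x) (format "x %:F") : ring_scope.

(* -------------------------------------------------------------------------- *)
(* The fraction field of an ordered domain, with the induced ordering:        *)
(* x >= 0 iff x = a / b with a >= 0 and b > 0.                                *)

Section FracOrder.
Variable D : realDomainType.
Local Notation F := {fraction D}.
Implicit Types x y : F.

Definition frac_ge0 x : bool :=
  `[< exists a b : D, [/\ 0 <= a, 0 < b & x = a%:F / b%:F] >].
Definition frac_le x y : bool := frac_ge0 (y - x).
Definition frac_lt x y : bool := (y != x) && frac_le x y.
Definition frac_norm x : F := if frac_ge0 x then x else - x.

Lemma frac_ratio x : exists a b : D, 0 < b /\ x = a%:F / b%:F.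
Proof.
elim/quotW: x => -[[a b] /= b0].
have b0F : b%:F != 0 by rewrite tofrac_eq0.
have -> : \pi_{fraction D} (@mkRatio D (a, b) b0) = a%:F / b%:F.
  apply: (mulIf b0F); rewrite mulfVK //.
  unlock FracField.tofrac; rewrite -[LHS]FracField.pi_mul.
  apply/eqmodP; rewrite /= FracField.equivfE /FracField.mulf.
  by rewrite !numden_Ratio ?mulr1 ?oner_eq0 //= mulrC.
case: (ltrgt0P b) b0 => // [b_gt0|b_lt0] _; first by exists a, b.
exists (- a), (- b); rewrite oppr_gt0; split=> //.
by rewrite !raddfN invrN mulrNN.
Qed.

Lemma frac_ge0D x y : frac_ge0 x -> frac_ge0 y -> frac_ge0 (x + y).
Proof.
move=> /asboolP[a [b [a0 b0 ->]]] /asboolP[c [d [c0 d0 ->]]].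
apply/asboolP; exists (a * d + c * b), (b * d).
rewrite addr_ge0 ?mulr_ge0 ?mulr_gt0 ?(ltW b0) ?(ltW d0)//; split=> //.
by rewrite addf_div ?tofrac_eq0 ?gt_eqF// !tofracD !tofracM.
Qed.

Lemma frac_ge0M x y : frac_ge0 x -> frac_ge0 y -> frac_ge0 (x * y).
Proof.
move=> /asboolP[a [b [a0 b0 ->]]] /asboolP[c [d [c0 d0 ->]]].
apply/asboolP; exists (a * c), (b * d).
by rewrite mulr_ge0 ?mulr_gt0 // mulf_div !tofracM.
Qed.

Lemma frac_ge0_anti x : frac_ge0 x -> frac_ge0 (- x) -> x = 0.
Proof.
move=> /asboolP[a [b [a0 b0 ->]]] /asboolP[c [d [c0 d0 /eqP]]].
have bF : b%:F != 0 by rewrite tofrac_eq0 gt_eqF.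
have dF : d%:F != 0 by rewrite tofrac_eq0 gt_eqF.
rewrite -mulNr eqr_div // -tofracN -!tofracM tofrac_eq mulNr => /eqP adcb.
suff -> : a = 0 by rewrite tofrac0 mul0r.
have ad0 : a * d <= 0 by rewrite -oppr_ge0 adcb mulr_ge0 // ltW.
by apply/eqP; rewrite eq_le a0 andbT -(pmulr_lle0 a d0).
Qed.

Lemma frac_ge0_total x : frac_ge0 x || frac_ge0 (- x).
Proof.
have [a [b [b0 ->]]] := frac_ratio x.
case: (leP 0 a) => [a0|/ltW a0].
  by apply/orP; left; apply/asboolP; exists a, b.
apply/orP; right; apply/asboolP; exists (- a), b.
by rewrite oppr_ge0 raddfN mulNr.
Qed.

Let le0_add x y : frac_le 0 x -> frac_le 0 y -> frac_le 0 (x + y).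
Proof. by rewrite /frac_le !subr0; exact: frac_ge0D. Qed.

Let le0_mul x y : frac_le 0 x -> frac_le 0 y -> frac_le 0 (x * y).
Proof. by rewrite /frac_le !subr0; exact: frac_ge0M. Qed.

Let le0_anti x : frac_le 0 x -> frac_le x 0 -> x = 0.
Proof. by rewrite /frac_le subr0 sub0r; exact: frac_ge0_anti. Qed.

Let sub_ge0 x y : frac_le 0 (y - x) = frac_le x y.
Proof. by rewrite /frac_le subr0. Qed.

Let le0_total x : frac_le 0 x || frac_le x 0.
Proof. by rewrite /frac_le subr0 sub0r; exact: frac_ge0_total. Qed.

Let normN x : frac_norm (- x) = frac_norm x.
Proof.
rewrite /frac_norm opprK; have := frac_ge0_total x.
case: (boolP (frac_ge0 x)) => xP; case: (boolP (frac_ge0 (- x))) => xN //= _.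
by rewrite (frac_ge0_anti xP xN) oppr0.
Qed.

Let ge0_norm x : frac_le 0 x -> frac_norm x = x.
Proof. by rewrite /frac_le subr0 /frac_norm => ->. Qed.

HB.instance Definition _ := Num.IntegralDomain_isLeReal.Build F
  le0_add le0_mul le0_anti sub_ge0 le0_total normN ge0_norm
  (fun _ _ => erefl).

End FracOrder.

(* -------------------------------------------------------------------------- *)
(* The multiplicative group of a field, written additively.                   *)

Record units_add (F : fieldType) := UnitsAdd {
  units_add_val : F;
  _ : units_add_val != 0
}.

Section UnitsAdd.
Variable F : fieldType.

HB.instance Definition _ := [isSub for @units_add_val F].
HB.instance Definition _ := [Choice of units_add F by <:].

Implicit Types x y z : units_add F.

Definition uadd0 : units_add F := UnitsAdd (oner_neq0 F).
Definition uaddD x y : units_add F := UnitsAdd (mulf_neq0 (valP x) (valP y)).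
Definition uaddN x : units_add F := UnitsAdd (invr_neq0 (valP x)).

Let uaddA : associative uaddD.
Proof. by move=> x y z; apply: val_inj; exact: mulrA. Qed.

Let uaddC : commutative uaddD.
Proof. by move=> x y; apply: val_inj; exact: mulrC. Qed.

Let uadd0r : left_id uadd0 uaddD.
Proof. by move=> x; apply: val_inj; exact: mul1r. Qed.

Let uaddNr : left_inverse uadd0 uaddN uaddD.
Proof. by move=> x; apply: val_inj; rewrite /= mulVf ?(valP x). Qed.

HB.instance Definition _ :=
  GRing.isZmodule.Build (units_add F) uaddA uaddC uadd0r uaddNr.

End UnitsAdd.

(* -------------------------------------------------------------------------- *)
(* The valuation attached to an ordered domain D: its valuation ring is the   *)
(* convex hull of D in {fraction D}, and its value group, the group of        *)
(* nonzero fractions modulo the units of that ring, is ordered by letting the *)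
(* class of x be nonnegative iff x is in the valuation ring.                  *)

Section Valuation.
Variable D : realDomainType.
Local Notation F := {fraction D}.

Definition val_ring : {pred F} :=
  fun x => `[< exists z : D, `|x| <= z%:F >].

Definition val_units : {pred units_add F} :=
  fun x => (val x \in val_ring) && ((val x)^-1 \in val_ring).

Lemma val_ring1 : 1 \in val_ring.
Proof. by apply/asboolP; exists 1; rewrite normr1 tofrac1. Qed.

Lemma val_ringM x y : x \in val_ring -> y \in val_ring -> x * y \in val_ring.
Proof.
move=> /asboolP[a xa] /asboolP[b yb]; apply/asboolP; exists (a * b).
by rewrite normrM tofracM ler_pM.
Qed.

Lemma val_ring_total x : x != 0 -> x \in val_ring \/ x^-1 \in val_ring.
Proof.
move=> x0; case: (leP `|x| 1) => [x1|/ltW x1].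
  by left; apply/asboolP; exists 1; rewrite tofrac1.
right; apply/asboolP; exists 1; rewrite tofrac1 normfV.
by rewrite invf_le1 ?normr_gt0.
Qed.

Lemma val_units_closed : zmod_closed val_units.
Proof.
split=> [|x y /andP[xR xVR] /andP[yR yVR]].
  by apply/andP; rewrite /= invr1 val_ring1.
by apply/andP; rewrite /= invfM invrK; split; exact: val_ringM.
Qed.

HB.instance Definition _ :=
  GRing.isZmodClosed.Build (units_add F) val_units val_units_closed.

Definition val_group := {ideal_quot val_units}.
HB.instance Definition _ := GRing.Zmodule.on val_group.

Definition val_class (x : units_add F) : val_group :=
  \pi_({ideal_quot val_units}) x.

Lemma val_class_is_zmod_morphism : zmod_morphism val_class.
Proof. by move=> x y; rewrite /val_class raddfB. Qed.

HB.instance Definition _ := GRing.isZmodMorphism.Build (units_add F) val_group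
  val_class val_class_is_zmod_morphism.

Lemma val_class_eq x y : (val_class x == val_class y) = (x - y \in val_units).
Proof. by rewrite Quotient.idealrBE. Qed.

Lemma val_classK (g : val_group) : val_class (repr g) = g.
Proof. exact: reprK. Qed.

Definition val_group_le (g h : val_group) : bool :=
  `[< exists x : units_add F, val x \in val_ring /\ h - g = val_class x >].
Definition val_group_lt (g h : val_group) : bool :=
  (h != g) && val_group_le g h.

Let val_group_refl : reflexive val_group_le.
Proof.
by move=> g; apply/asboolP; exists 0; rewrite subrr raddf0 val_ring1.
Qed.

Let val_group_anti : antisymmetric val_group_le.
Proof.
move=> g h /andP[/asboolP[x [xR hg]] /asboolP[y [yR gh]]].
apply/eqP; rewrite eq_sym -subr_eq0 hg -(raddf0 val_class) val_class_eq subr0.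
have /eqP : val_class (- y) = val_class x by rewrite raddfN /= -gh -hg opprB.
rewrite val_class_eq => /andP[/= yxR _].
apply/andP; split=> //=.
have -> : (val x)^-1 = (val y)^-1 / val x * val y.
  by rewrite mulrAC mulVf ?mul1r// (valP y).
exact: val_ringM.
Qed.

Let val_group_trans : transitive val_group_le.
Proof.
move=> h g k /asboolP[x [xR hg]] /asboolP[y [yR kh]].
apply/asboolP; exists (y + x); split; first exact: val_ringM.
by rewrite raddfD /= -hg -kh addrA subrK.
Qed.

Let val_group_total : total val_group_le.
Proof.
move=> g h; have cK := val_classK (h - g).
have [xR|xR] := val_ring_total (valP (repr (h - g))); apply/orP.
  by left; apply/asboolP; exists (repr (h - g)).
right; apply/asboolP; exists (- repr (h - g)); split=> //.
by rewrite raddfN /= cK opprB.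
Qed.

(* The display makes val_group a porderZmodType.                              *)
HB.instance Definition _ := Order.isPOrder.Build ring_display val_group
  (fun _ _ => erefl) val_group_refl val_group_anti val_group_trans.
HB.instance Definition _ :=
  Order.POrder_isTotal.Build ring_display val_group val_group_total.

(* [None] stands for the value infinity of 0.                                 *)
Definition nu (x : F) : option val_group := omap val_class (insub x).

End Valuation.

(* -------------------------------------------------------------------------- *)
(* The tensor product of two abelian groups over Z: the free abelian group    *)
(* on U * V modulo the subgroup generated by the biadditivity relations.      *)

Section Tensor.
Variables U V : zmodType.

Inductive tensor_rel : {freeg (U * V)} -> Prop :=
| TensorDl u u' v : tensor_rel (<<(u + u', v)>> - <<(u, v)>> - <<(u', v)>>)
| TensorDr u v v' : tensor_rel (<<(u, v + v')>> - <<(u, v)>> - <<(u, v')>>).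

Definition tensor_null : {pred {freeg (U * V)}} :=
  fun x => `[< forall S : {pred {freeg (U * V)}},
    zmod_closed S -> (forall r, tensor_rel r -> r \in S) -> x \in S >].

Lemma tensor_null_closed : zmod_closed tensor_null.
Proof.
split=> [|x y /asboolP xN /asboolP yN]; apply/asboolP => S cS SR.
  by case: cS.
by case: (cS) => _; apply; [exact: xN|exact: yN].
Qed.

HB.instance Definition _ :=
  GRing.isZmodClosed.Build {freeg (U * V)} tensor_null tensor_null_closed.

Definition tensor := {ideal_quot tensor_null}.
HB.instance Definition _ := GRing.Zmodule.on tensor.

Definition tens (u : U) (v : V) : tensor :=
  \pi_({ideal_quot tensor_null}) <<(u, v)>>.

End Tensor.

(* The order induced on the tensor product of G and Q by an ordered group G:  *)
(* t > 0 iff some positive integer multiple of t is the image of a positive   *)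
(* element of G.                                                              *)
Definition tensQ_gt0 (G : porderZmodType) (t : tensor G rat) : Prop :=
  exists (m : nat) (g : G), [/\ (0 < m)%N, 0 < g & t *+ m = tens g 1].

(* -------------------------------------------------------------------------- *)
(* The real spectrum.                                                         *)

Definition ring_order (T : pzRingType) (le : rel T) : Prop :=
  [/\ reflexive le, antisymmetric le, transitive le, total le &
      (forall z, {homo +%R z : x y / le x y}) /\
      (forall x y, le 0 x -> le 0 y -> le 0 (x * y))].

Record sper (B : comNzRingType) := Sper {
  supp : prime_idealr B;
  sper_le : rel {ideal_quot supp};
  sper_leP : ring_order sper_le
}.

(* B[alpha] = B / supp alpha, ordered by alpha. A copy of the quotient type   *)
(* is needed so that instances may depend on the ordering. Being a unit is    *)
(* decided classically.                                                       *)
Definition sper_ring (B : comNzRingType) (alpha : sper B) : Type :=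
  {ideal_quot (supp alpha)}.

Section SperRing.
Variables (B : comNzRingType) (alpha : sper B).
Local Notation Ba := (sper_ring alpha).

HB.instance Definition _ := GRing.ComNzRing.on Ba.

Implicit Types x y : Ba.

Definition sper_unit : pred Ba := fun x => `[< exists y, y * x = 1 >].
Definition sper_inv x : Ba :=
  if pselect (exists y, y * x = 1) is left ex then sval (cid ex) else x.

Let sper_mulVr : {in sper_unit, left_inverse 1 sper_inv *%R}.
Proof.
by move=> x /asboolP ex; rewrite /sper_inv; case: pselect => // e; case: cid.
Qed.

Let sper_unitP x y : y * x = 1 -> sper_unit x.
Proof. by move=> yx; apply/asboolP; exists y. Qed.

Let sper_invr_out : {in [predC sper_unit], sper_inv =1 id}.
Proof.
by move=> x /asboolPn nex; rewrite /sper_inv; case: pselect.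
Qed.

HB.instance Definition _ := GRing.ComNzRing_hasMulInverse.Build Ba
  sper_mulVr sper_unitP sper_invr_out.

Let sper_idomain x y : x * y = 0 -> (x == 0) || (y == 0).
Proof. exact: Quotient.rquot_IdomainAxiom. Qed.

HB.instance Definition _ :=
  GRing.ComUnitRing_isIntegral.Build Ba sper_idomain.

Local Notation le := (@sper_le B alpha : rel Ba).

Definition sper_lt x y : bool := (y != x) && le x y.
Definition sper_norm x : Ba := if le 0 x then x else - x.

Let le_add z x y : le x y -> le (z + x) (z + y).
Proof. by have [_ _ _ _ [+ _]] := sper_leP alpha; apply. Qed.

Let le_trans x y z : le x y -> le y z -> le x z.
Proof. by have [_ _ tr _ _] := sper_leP alpha; exact: tr. Qed.

Let le_anti x y : le x y -> le y x -> x = y.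
Proof.
by have [_ anti _ _ _] := sper_leP alpha => xy yx; apply: anti; rewrite xy.
Qed.

Let le0_add x y : le 0 x -> le 0 y -> le 0 (x + y).
Proof.
by move=> x0 y0; apply: (le_trans x0); rewrite -{1}[x]addr0; exact: le_add.
Qed.

Let le0_mul x y : le 0 x -> le 0 y -> le 0 (x * y).
Proof. by have [_ _ _ _ [_ +]] := sper_leP alpha; apply. Qed.

Let le0_anti x : le 0 x -> le x 0 -> x = 0.
Proof. by move=> x0 /le_anti; apply. Qed.

Let sub_ge0 x y : le 0 (y - x) = le x y.
Proof.
apply/idP/idP => [/(le_add x)|/(le_add (- x))].
  by rewrite addr0 addrC subrK.
by rewrite addNr addrC.
Qed.

Let le0_total x : le 0 x || le x 0.
Proof. by have [_ _ _ tot _] := sper_leP alpha; exact: tot. Qed.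

Let normN x : sper_norm (- x) = sper_norm x.
Proof.
have leN : le 0 (- x) = le x 0 by rewrite -[RHS]sub_ge0 sub0r.
rewrite /sper_norm leN opprK; have := le0_total x.
case: (boolP (le 0 x)) => x0; case: (boolP (le x 0)) => x0' //= _.
by rewrite (le0_anti x0 x0') oppr0.
Qed.

Let ge0_norm x : le 0 x -> sper_norm x = x.
Proof. by rewrite /sper_norm => ->. Qed.

HB.instance Definition _ := Num.IntegralDomain_isLeReal.Build Ba
  le0_add le0_mul le0_anti sub_ge0 le0_total normN ge0_norm
  (fun _ _ => erefl).

Definition sper_eval (f : B) : Ba := \pi_({ideal_quot (supp alpha)}) f.

End SperRing.

Section SperTopology.
Variable B : comNzRingType.

HB.instance Definition _ := gen_eqMixin (sper B).
HB.instance Definition _ := gen_choiceMixin (sper B).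

Definition sper_basic (fs : seq B) : set (sper B) :=
  [set alpha | forall f, f \in fs -> 0 < sper_eval alpha f].

Let sper_basic_cover : \bigcup_(fs in [set: seq B]) sper_basic fs = setT.
Proof. by rewrite -subTset => alpha _; exists [::]. Qed.

Let sper_basic_join fs gs alpha :
  [set: seq B] fs -> [set: seq B] gs ->
  sper_basic fs alpha -> sper_basic gs alpha ->
  exists hs, [/\ [set: seq B] hs, sper_basic hs alpha &
    sper_basic hs `<=` sper_basic fs `&` sper_basic gs].
Proof.
move=> _ _ fa ga; exists (fs ++ gs); split=> //.
  by move=> f; rewrite mem_cat => /orP[/fa|/ga].
by move=> beta fgb; split=> f ff; apply: fgb; rewrite mem_cat ff ?orbT.
Qed.

HB.instance Definition _ := isPointed.Build (seq B) [::].
HB.instance Definition _ := isBaseTopological.Build (sper B)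
  sper_basic_cover sper_basic_join.

End SperTopology.

Definition sper_nu (B : comNzRingType) (alpha : sper B) (f : B) :
    option (val_group (sper_ring alpha)) :=
  nu (sper_eval alpha f)%:F.

(* Main.v *)
(* Every point of S is joined inside S to the point x_i = eps^(a_i), where eps
   is an infinitesimal and a is a natural exponent vector satisfying the
   relations omega.a > 0 and theta.a = 0; such a vector exists by Gordan's
   theorem. The paths are monomial curves x_i = c_i tau^(e_i), tau running
   through an interval of an ordered field L extending the residue field K of
   the point: first multiply x_i by tau^(a_i), tau going from 1 to an eps
   infinitesimal over K, which leaves only the conditions on theta to be
   respected, then bring the remaining factors x_i to 1. The coordinates x_i > 1
   bound the values of all polynomials, so they are kept fixed until the other
   ones are equal to 1; a Smith normal form of theta provides the directions in
   which the latter are moved. Two end points with different exponents are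
   joined by applying the same construction to one of them.

   A curve tau -> c_i tau^(e_i) contained in S lies on one side of any
   separation of S: the real spectrum of L[X] is compact in the constructible
   topology, so finitely many polynomials are involved, and these change sign
   only at roots lying in a suitable ordered extension of L, by the
   Artin-Schreier extension argument. No real closure is needed. *)

Require Import Defs.
From HB Require Import structures.
From mathcomp Require Import all_boot all_order all_algebra.
From mathcomp Require Import generic_quotient ring_quotient fraction.
From mathcomp Require Import freeg mpoly lra zify.
From mathcomp Require Import boolp classical_sets filter topology_structure connected.

Set Implicit Arguments.
Unset Strict Implicit.
Unset Printing Implicit Defensive.

Import Order.TTheory GRing.Theory Num.Theory.

Local Open Scope ring_scope.
Local Open Scope quotient_scope.
Local Open Scope classical_set_scope.

(** * Prime cones and points of the real spectrum *)

(** A point is handled through its coordinates in an ordered field, and that field is enlarged at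
    will. The conditions on values are used multiplicatively, after clearing denominators: value 0
    means that a monomial is a unit of the convex hull of $A$, positive value that its inverse lies
    outside this hull. The hull depends on the point and changes along a path; most estimates
    compare two hulls by means of convex subrings. Curves are followed over all ordered extensions
    of $L$ because a cover of the $L$-points of an interval alone need not have a finite subcover.
    Real closedness enters through squares: they determine the order of $R$, so every morphism from
    $R$ to an ordered field is monotone, and the sign of a polynomial at an element infinitesimal
    over $R$ does not depend on the field containing that element. This identifies end points that
    live in unrelated fields. *)

Section ConeIdentities.
Variable B : comNzRingType.
Implicit Types a b c d f g : B.

Lemma cone_identM a b c d f :
  (a + f * b) * (c + f * d) = a * c + f * f * (b * d) + f * (a * d + b * c).
Proof.
rewrite mulrDl !mulrDr [X in _ + X]addrC addrACA; congr (_ + _ + (_ + _)).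
- exact: mulrACA.
- exact: mulrCA.
- by rewrite mulrA.
Qed.

(** The hypotheses multiply to $(1+a)(1+c) = fg\,bd$. With [g = - f] the factor [- (f * g)] is a
    square; with [- (f * g)] in the cone it is nonnegative. In both cases [-1] falls into the
    cone. *)
Lemma cone_identN a b c d f g : -1 = a + f * b -> -1 = c + g * d ->
  -1 = a + c + a * c + - (f * g) * (b * d).
Proof.
move=> ab cd.
have -> : - (f * g) * (b * d) = - ((1 + a) * (1 + c)).
  have -> : 1 + a = - (f * b) by rewrite -[1]opprK ab opprD addrAC addNr add0r.
  have -> : 1 + c = - (g * d) by rewrite -[1]opprK cd opprD addrAC addNr add0r.
  by rewrite mulrNN mulNr mulrACA.
have -> : (1 + a) * (1 + c) = 1 + (a + c + a * c).
  by rewrite mulrDl !mulrDr !(mul1r, mulr1) -!addrA [c + _]addrCA.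
by rewrite opprD [RHS]addrC subrK.
Qed.

End ConeIdentities.

Section Cones.
Variable B : comNzRingType.
Implicit Types (P T : set B) (f g : B).

Definition preorder_cone P : Prop :=
  [/\ forall f g, P f -> P g -> P (f + g),
      forall f g, P f -> P g -> P (f * g),
      forall f, P (f * f) & ~ P (-1)].

(** These are the sets of elements nonnegative at a point of the spectrum. The last clause makes the
    support $P\cap -P$ prime. *)
Definition prime_cone P : Prop :=
  [/\ preorder_cone P, forall f, P f \/ P (- f) &
      forall f g, P (f * g) -> P (- (f * g)) ->
        (P f /\ P (- f)) \/ (P g /\ P (- g))].

Section OfCone.
Variables (P : set B) (coneP : prime_cone P).

Let PD f g : P f -> P g -> P (f + g).
Proof. by have [[+ _ _ _] _ _] := coneP; apply. Qed.
Let PM f g : P f -> P g -> P (f * g).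
Proof. by have [[_ + _ _] _ _] := coneP; apply. Qed.
Let P2 f : P (f * f).
Proof. by have [[_ _ + _] _ _] := coneP; apply. Qed.
Let PN1 : ~ P (-1).
Proof. by have [[_ _ _ +] _ _] := coneP. Qed.
Let Ptot f : P f \/ P (- f).
Proof. by have [_ + _] := coneP; apply. Qed.
Let Pprime f g : P (f * g) -> P (- (f * g)) ->
  (P f /\ P (- f)) \/ (P g /\ P (- g)).
Proof. by have [_ _ +] := coneP; apply. Qed.
Let P0 : P 0. Proof. by rewrite -(mulr0 0). Qed.

Definition cone_supp : {pred B} := fun f => `[< P f /\ P (- f) >].

Let cone_suppM f g : f \in cone_supp -> g * f \in cone_supp.
Proof.
move=> /asboolP[fP fN]; apply/asboolP; have [gP|gN] := Ptot g.
  by rewrite -mulrN; split; apply: PM.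
by rewrite -[g * f]mulrNN -mulrN opprK; split; apply: PM.
Qed.

Lemma cone_supp_idealr : idealr_closed cone_supp.
Proof.
split=> [||a f g fS gS].
- by apply/asboolP; rewrite oppr0.
- by apply/negP => /asboolP[].
- have /asboolP[afP afN] := cone_suppM a fS; move: gS => /asboolP[gP gN].
  by apply/asboolP; rewrite opprD; split; apply: PD.
Qed.

Lemma cone_supp_prime : prime_idealr_closed cone_supp.
Proof.
move=> f g /asboolP[fgP fgN].
by have [?|?] := Pprime fgP fgN; apply/orP; [left|right]; apply/asboolP.
Qed.

HB.instance Definition _ := isIdealr.Build B cone_supp cone_supp_idealr.
HB.instance Definition _ :=
  isPrimeIdealrClosed.Build B cone_supp cone_supp_prime.

Local Notation Q := {ideal_quot cone_supp}.

Definition cone_le (x y : Q) : bool := `[< P (repr y - repr x) >].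

Let P_mod f g : f = g %[mod Q] -> P f -> P g.
Proof.
move/eqP; rewrite -Quotient.idealrBE => /asboolP[_ fgN] fP.
by rewrite -[g](subrK f) addrC; apply: PD => //; rewrite -opprB.
Qed.

Let cone_leE f g : cone_le (\pi_Q f) (\pi_Q g) <-> P (g - f).
Proof.
have e : repr (\pi_Q g) - repr (\pi_Q f) = g - f %[mod Q].
  by rewrite !raddfB /= !reprK.
split=> [/asboolP gf|gf]; first exact: P_mod e gf.
by apply/asboolP; exact: P_mod (esym e) gf.
Qed.

Lemma cone_le_order : ring_order cone_le.
Proof.
split.
- by move=> x; apply/asboolP; rewrite subrr.
- move=> x y /andP[/asboolP xy /asboolP yx]; rewrite -[x]reprK -[y]reprK.
  apply/eqP; rewrite -Quotient.idealrBE; apply/asboolP.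
  by rewrite opprB.
- move=> y x z /asboolP xy /asboolP yz; apply/asboolP.
  by rewrite -(subrK (repr y) (repr z)) -addrA; apply: PD.
- move=> x y; apply/orP; have [xy|xy] := Ptot (repr y - repr x).
    by left; apply/asboolP.
  by right; apply/asboolP; rewrite -opprB.
- split=> [z x y|x y].
    rewrite -[x]reprK -[y]reprK -[z]reprK -!raddfD => /cone_leE xy.
    by apply/cone_leE; rewrite opprD addrACA subrr add0r.
  have Q0 : 0 = \pi_Q 0 by rewrite raddf0.
  rewrite -[x]reprK -[y]reprK Q0 => /cone_leE + /cone_leE.
  rewrite !subr0 => x0 y0; rewrite -rmorphM; apply/cone_leE.
  by rewrite subr0; apply: PM.
Qed.

Definition sper_of_cone : sper B := Sper cone_le_order.

Lemma sper_of_cone_ge0 f : (0 <= sper_eval sper_of_cone f) <-> P f.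
Proof. by rewrite -{2}[f]subr0 -cone_leE raddf0. Qed.

Lemma sper_of_cone_gt0 f : (0 < sper_eval sper_of_cone f) <-> ~ P (- f).
Proof.
rewrite -sper_of_cone_ge0 /sper_eval raddfN oppr_ge0.
by split=> [fP|/negP]; [rewrite leNgt fP | rewrite -ltNge].
Qed.

End OfCone.

(** A maximal preordering $P$ above [T] is prime: if $f\notin P$, maximality puts $-1$ in $P+fP$,
    and two such relations combine to put $-1$ in $P$ itself. *)
Lemma preorder_cone_prime T : preorder_cone T ->
  exists2 P, prime_cone P & T `<=` P.
Proof.
move=> coneT.
(* The property is imposed on the union of [T] with the variable set, so that it also holds for the
   empty union, which Zorn's lemma requires. *)
have [F FU Ftot|A [coneA Amax]] :=
    @Zorn_bigcup B (fun X => preorder_cone (T `|` X)).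
  have Pin f : (T `|` \bigcup_(X in F) X) f ->
      T f \/ exists2 X, F X & X f.
    by move=> [|[X FX Xf]]; [left|right; exists X].
  have Pout X f : F X -> (T `|` X) f -> (T `|` \bigcup_(X in F) X) f.
    by move=> FX [|]; [left|right; exists X].
  have Pcommon f g : (T `|` \bigcup_(X in F) X) f ->
      (T `|` \bigcup_(X in F) X) g ->
      (T f /\ T g) \/ exists X, [/\ F X, (T `|` X) f & (T `|` X) g].
    move=> /Pin[Tf|[X FX Xf]] /Pin[Tg|[Y FY Yg]]; first by left.
    - by right; exists Y; split=> //; [left|right].
    - by right; exists X; split=> //; [right|left].
    - right; have [XY|YX] := Ftot _ _ FX FY.
        by exists Y; split=> //; right=> //; apply: XY.
      by exists X; split=> //; right=> //; apply: YX.
  case: coneT => TD TM T2 TN1; split.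
  - move=> f g Pf Pg; have [[Tf Tg]|[X [FX Xf Xg]]] := Pcommon _ _ Pf Pg.
      by left; apply: TD.
    by apply: (Pout _ _ FX); have [+ _ _ _] := FU _ FX; apply.
  - move=> f g Pf Pg; have [[Tf Tg]|[X [FX Xf Xg]]] := Pcommon _ _ Pf Pg.
      by left; apply: TM.
    by apply: (Pout _ _ FX); have [_ + _ _] := FU _ FX; apply.
  - by move=> f; left.
  - by move=> /Pin[//|[X FX Xf]]; have [_ _ _ +] := FU _ FX; apply; right.
set P := T `|` A in coneA; exists P; last by move=> f; left.
have [PD PM P2 PN1] := coneA.
have P0 : P 0 by rewrite -(mulr0 0).
have P1 : P 1 by rewrite -(mulr1 1).
(* Otherwise P + f P would be a strictly larger preordering. *)
have Pnin f : ~ P f -> exists a b, [/\ P a, P b & -1 = a + f * b].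
  move=> nPf; apply: contrapT => nab.
  pose A' := [set g | exists a b, [/\ P a, P b & g = a + f * b]].
  have PA' : P `<=` A' by move=> g Pg; exists g, 0; rewrite mulr0 addr0.
  apply: (Amax A').
    split=> [|A'A]; first by move=> g Ag; apply: PA'; right.
    apply: nPf; right; apply: A'A.
    by exists 0, 1; rewrite add0r mulr1.
  have -> : T `|` A' = A'.
    by rewrite setUidr // => g Tg; apply: PA'; left.
  split.
  - move=> _ _ [a [b [Pa Pb ->]]] [c [d [Pc Pd ->]]].
    exists (a + c), (b + d); split; [exact: PD|exact: PD|].
    by rewrite mulrDr addrACA.
  - move=> _ _ [a [b [Pa Pb ->]]] [c [d [Pc Pd ->]]].
    exists (a * c + f * f * (b * d)), (a * d + b * c).
    split; last exact: cone_identM.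
      by apply: (PD _ _ (PM _ _ Pa Pc)); apply: (PM _ _ (P2 f)); exact: PM.
    by apply: (PD); apply: (PM).
  - by move=> g; apply: PA'.
  - by move=> [a [b ab]]; apply: nab; exists a, b.
have Ptot f : P f \/ P (- f).
  apply: contrapT => /not_orP[/Pnin[a [b [Pa Pb ab]]] /Pnin[c [d [Pc Pd cd]]]].
  apply: PN1; rewrite (cone_identN ab cd) mulrN opprK.
  apply: (PD _ _ _ (PM _ _ (P2 f) (PM _ _ Pb Pd))).
  by apply: (PD); [exact: PD|exact: PM].
split=> // f g.
have key f1 g1 : P (f1 * g1) -> P (- (f1 * g1)) -> ~ P f1 -> ~ P g1 -> False.
  move=> fgP fgN /Pnin[a [b [Pa Pb ab]]] /Pnin[c [d [Pc Pd cd]]].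
  apply: PN1; rewrite (cone_identN ab cd).
  apply: (PD _ _ _ (PM _ _ fgN (PM _ _ Pb Pd))).
  by apply: (PD); [exact: PD|exact: PM].
move=> fgP fgN; apply: contrapT => /not_orP[/not_andP nf /not_andP ng].
(* A sign change of [f] or [g] only swaps [f * g] with its negative, and both lie in [P]; signs are
   chosen so that neither factor is in [P]. *)
case: nf ng => [nf|nf] [ng|ng].
- exact: key fgP fgN nf ng.
- by apply: (key f (- g)); rewrite ?mulrN ?opprK.
- by apply: (key (- f) g); rewrite ?mulNr ?opprK.
- by apply: (key (- f) (- g)); rewrite ?mulrNN.
Qed.

Section OfMorphism.
Variables (E : realDomainType) (phi : {rmorphism B -> E}).

Lemma rmorphism_cone : prime_cone [set f | 0 <= phi f].
Proof.
split=> /=.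
- split=> /=.
  + by move=> f g; rewrite rmorphD; exact: addr_ge0.
  + by move=> f g; rewrite rmorphM; exact: mulr_ge0.
  + by move=> f; rewrite rmorphM -expr2 sqr_ge0.
  + by rewrite rmorphN1 oppr_ge0 ler10.
- by move=> f; rewrite rmorphN oppr_ge0; apply/orP; exact: le_total.
move=> f g; rewrite !rmorphN !oppr_ge0 rmorphM => fg0 fg0'.
have /eqP : phi f * phi g = 0 by apply/eqP; rewrite eq_le fg0 fg0'.
by rewrite mulf_eq0 => /orP[] /eqP ->; [left|right]; rewrite lexx.
Qed.

Definition sper_of : sper B := sper_of_cone rmorphism_cone.

Lemma sper_of_gt0 f : (0 < sper_eval sper_of f) = (0 < phi f).
Proof.
apply/idP/idP => [/sper_of_cone_gt0|fP].
  by rewrite /= rmorphN oppr_ge0 => /negP; rewrite -ltNge.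
by apply/sper_of_cone_gt0; rewrite /= rmorphN oppr_ge0 leNgt fP.
Qed.

End OfMorphism.

Definition residue_field (alpha : sper B) : realFieldType :=
  {fraction (sper_ring alpha)}.

Definition residue (alpha : sper B) : B -> residue_field alpha :=
  fun f => (sper_eval alpha f)%:F.

End Cones.

Section Residue.
Variables (B : comNzRingType) (alpha : sper B).

Lemma sper_eval_zmod : zmod_morphism (sper_eval alpha).
Proof. by move=> x y; rewrite /sper_eval raddfB. Qed.
Lemma sper_eval_monoid : monoid_morphism (sper_eval alpha).
Proof. by split=> [|x y]; rewrite /sper_eval ?rmorph1 ?rmorphM. Qed.
HB.instance Definition _ :=
  GRing.isZmodMorphism.Build B (sper_ring alpha) (sper_eval alpha) sper_eval_zmod.
HB.instance Definition _ :=
  GRing.isMonoidMorphism.Build B (sper_ring alpha) (sper_eval alpha)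
    sper_eval_monoid.

HB.instance Definition _ := GRing.RMorphism.copy (residue alpha)
  (@FracField.tofrac (sper_ring alpha) \o sper_eval alpha).

End Residue.

Lemma tofrac_ge0 (D : realDomainType) (a : D) : (0 <= a%:F) = (0 <= a).
Proof.
have tofrac_ge0' (b : D) : 0 <= b -> 0 <= b%:F.
  move=> b0; rewrite [_ <= _](_ : _ = frac_ge0 (b%:F - 0)) // subr0.
  by apply/asboolP; exists b, 1; rewrite ltr01 tofrac1 divr1.
apply/idP/idP => [|/tofrac_ge0' //]; apply: contraTT; rewrite -!ltNge => a0.
rewrite lt_neqAle tofrac_eq0 lt_eqF //= -oppr_ge0 -raddfN.
by apply: tofrac_ge0'; rewrite oppr_ge0 ltW.
Qed.

Lemma tofrac_gt0 (D : realDomainType) (a : D) : (0 < a%:F) = (0 < a).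
Proof. by rewrite !lt_neqAle tofrac_ge0 ![0 == _]eq_sym tofrac_eq0. Qed.

Lemma residue_gt0 (B : comNzRingType) (alpha : sper B) f :
  (0 < residue alpha f) = (0 < sper_eval alpha f).
Proof. exact: tofrac_gt0. Qed.

Lemma residue_ge0 (B : comNzRingType) (alpha : sper B) f :
  (0 <= residue alpha f) = (0 <= sper_eval alpha f).
Proof. exact: tofrac_ge0. Qed.

(** * Ordered extensions with a prescribed root *)

(** An ordered field is infinite. Polynomial identities below are thus reduced to identities between
    values, within reach of [lra]. *)
Lemma poly_funext (K : realFieldType) (p q : {poly K}) :
  (forall x, p.[x] = q.[x]) -> p = q.
Proof.
move=> pq; apply/eqP; rewrite -subr_eq0; apply/eqP.
apply: (@roots_geq_poly_eq0 _ _ [seq i%:R | i <- iota 0 (size (p - q))]).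
- by apply/allP => _ /mapP[i _ ->]; rewrite /root hornerD hornerN pq subrr.
- by rewrite map_inj_uniq ?iota_uniq // => i j /eqP; rewrite eqr_nat => /eqP.
- by rewrite size_map size_iota.
Qed.

Section SumsOfSquares.
Variable K : realFieldType.
Implicit Types (p q f g h : {poly K}) (Q : pred {poly K}).

(** The weights [c] are needed because a nonnegative element of [K] need not be a square. [Q]
    carries a degree bound on the polynomials being squared. *)
Inductive sos Q : {poly K} -> Prop :=
| sos0 : sos Q 0
| sosD c q f : 0 <= c -> Q q -> sos Q f -> sos Q (c *: (q * q) + f).

Lemma sos_ge0 Q f x : sos Q f -> 0 <= f.[x].
Proof.
elim=> {f} [|c q f c0 _ _ IH]; first by rewrite horner0.
by rewrite hornerD hornerZ hornerM -expr2 addr_ge0 // mulr_ge0 // sqr_ge0.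
Qed.

Lemma sos_size d f : sos [pred q : {poly K} | size q <= d]%N f ->
  (size f <= (d + d).-1)%N.
Proof.
elim=> {f} [|c q f _ /= qd _ IH]; first by rewrite size_poly0.
rewrite (leq_trans (size_polyD _ _)) // geq_max IH andbT.
rewrite (leq_trans (size_scale_leq _ _)) // (leq_trans (size_polyMleq _ _)) //.
by move: (size q) qd => a; lia.
Qed.

Local Notation sosT := (sos predT).

Lemma sos_add f g : sosT f -> sosT g -> sosT (f + g).
Proof.
move=> + gS; elim=> {f} [|c q f c0 _ _ IH]; first by rewrite add0r.
by rewrite -addrA; apply: sosD.
Qed.

Lemma sos_scale c f : 0 <= c -> sosT f -> sosT (c *: f).
Proof.
move=> c0; elim=> {f} [|d q f d0 _ _ IH]; first by rewrite scaler0; exact: sos0.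
by rewrite scalerDr scalerA; apply: sosD => //; exact: mulr_ge0.
Qed.

Lemma sos_sqrM p f : sosT f -> sosT (p * p * f).
Proof.
elim=> {f} [|d q f d0 _ _ IH]; first by rewrite mulr0; exact: sos0.
rewrite mulrDr -scalerAr mulrACA. by apply: sosD.
Qed.

Lemma sos_mul f g : sosT f -> sosT g -> sosT (f * g).
Proof.
move=> + gS; elim=> {f} [|c q f c0 _ _ IH]; first by rewrite mul0r; exact: sos0.
by rewrite mulrDl -scalerAl; apply: sos_add => //; apply/sos_scale/sos_sqrM.
Qed.

Lemma sos_sqr p : sosT (p * p).
Proof. by rewrite -[_ * _]addr0 -[p * p]scale1r; exact: sosD ler01 isT (sos0 _). Qed.

Lemma sos_modp p f : p != 0 -> sosT f ->
  exists g h, sos [pred q : {poly K} | size q <= (size p).-1]%N g /\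
    f = g + p * h.
Proof.
move=> p0; elim=> {f} [|c q f c0 _ _ [g [h [gS ->]]]].
  by exists 0, 0; rewrite mulr0 addr0; split=> //; exact: sos0.
exists (c *: (q %% p * (q %% p)) + g).
(* With $r$ the remainder of $q$ modulo $p$, $q^2 - r^2 = (q-r)(q+r)$, and $q-r$ is the quotient
   times $p$. *)
exists (c *: (q %/ p * (q + q %% p)) + h); split.
  apply: sosD => //=; have := ltn_modpN0 q p0.
  by move: (size (q %% p)) (size p) => a b; lia.
apply: poly_funext => x; have := congr1 (horner^~ x) (divp_eq q p).
by rewrite !hornerE /= => ->; lra.
Qed.

(* If -1 were in the cone generated by X - s and t - X modulo p, then
   reducing the squares modulo p gives a cofactor h of p of smaller degree
   which also changes sign between s and t. *)
Lemma sign_change_not_nonneg (s t : K) p s1 s2 h : s < t ->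
  p.[s] * p.[t] < 0 -> sosT s1 -> sosT s2 ->
  -1 <> s1 * ('X - s%:P) + s2 * (t%:P - 'X) + p * h.
Proof.
move=> st; elim: {p}(size p) {-2}p (leqnn (size p)) s1 s2 h => [|k IH] p pk s1 s2 h.
  by move: pk; rewrite leqn0 size_poly_eq0 => /eqP ->; rewrite !horner0 mulr0 ltxx.
move=> pst s1S s2S; have p0 : p != 0.
  by apply/eqP => p0; move: pst; rewrite p0 !horner0 mulr0 ltxx.
have sp1 : (1 < size p)%N.
  rewrite ltnNge; apply/negP => /size1_polyC pE.
  by move: pst; rewrite pE !hornerC -expr2 ltNge sqr_ge0.
have [g1 [h1 [g1S ->]]] := sos_modp p0 s1S.
have [g2 [h2 [g2S ->]]] := sos_modp p0 s2S.
set h' := h + h1 * ('X - s%:P) + h2 * (t%:P - 'X) => e1.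
have {}e1 : -1 = g1 * ('X - s%:P) + g2 * (t%:P - 'X) + p * h'.
  rewrite {}e1; apply: poly_funext => x; rewrite /h' !hornerE /=; lra.
have sosW f : sos [pred q : {poly K} | size q <= (size p).-1]%N f -> sosT f.
  by elim=> {f} [|c q f c0 _ _]; [exact: sos0|exact: sosD].
(* At $s$ the term with factor $X-s$ vanishes, leaving $p(s)h'(s) = -1-g_2(s)(t-s)$; similarly at
   $t$. *)
have ph's : p.[s] * h'.[s] < 0.
  have := congr1 (horner^~ s) e1; have := sos_ge0 s g2S.
  rewrite !hornerE /= subrr mulr0 add0r => g2s es.
  have : 0 <= g2.[s] * (t - s) by apply: mulr_ge0; lra.
  lra.
have ph't : p.[t] * h'.[t] < 0.
  have := congr1 (horner^~ t) e1; have := sos_ge0 t g1S.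
  rewrite !hornerE /= subrr mulr0 addr0 => g1t et.
  have : 0 <= g1.[t] * (t - s) by apply: mulr_ge0; lra.
  lra.
have h'st : h'.[s] * h'.[t] < 0.
  have : 0 < (p.[s] * p.[t]) * (h'.[s] * h'.[t]).
    by rewrite mulrACA nmulr_rgt0.
  by rewrite nmulr_rgt0.
have h'0 : h' != 0.
  by apply/eqP => h0; move: h'st; rewrite h0 !horner0 mulr0 ltxx.
(* The remainders have degree below $\deg p$, so $ph'$ has degree at most $2(\deg p-1)+1$, whence
   $\deg h'<\deg p$. The induction then applies with [p] and [h'] exchanged. *)
have sh' : (size h' <= k)%N.
  have e2 : p * h' = - (1 + g1 * ('X - s%:P) + g2 * (t%:P - 'X)).
    by apply: poly_funext => x; have := congr1 (horner^~ x) e1; rewrite !hornerE /=; lra.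
  have := size_mul p0 h'0; rewrite e2 size_polyN.
  set G := 1 + _ + _ => sG.
  suff : (size G <= ((size p).-1 + (size p).-1))%N by move: sp1 pk; rewrite sG; move: (size p) (size h') => a b; lia.
  have tX : (size (t%:P - 'X : {poly K})%R <= 2)%N.
    by rewrite -opprB size_polyN size_XsubC.
  have mul_bound (g r : {poly K}) : (size g <= ((size p).-1 + (size p).-1).-1)%N ->
      (size r <= 2)%N -> (size (g * r)%R <= ((size p).-1 + (size p).-1))%N.
    move=> gp r2; apply: (leq_trans (size_polyMleq _ _)).
    by move: gp r2 sp1; move: (size g) (size r) (size p) => x y z; lia.
  rewrite /G (leq_trans (size_polyD _ _)) // geq_max; apply/andP; split.
    rewrite (leq_trans (size_polyD _ _)) // geq_max size_poly1.
    apply/andP; split; first by move: sp1; move: (size p) => a; lia.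
    by apply: mul_bound; rewrite ?size_XsubC //; exact: sos_size.
  by apply: mul_bound => //; exact: sos_size.
apply: (IH h' sh' g1 g2 p h'st (sosW _ g1S) (sosW _ g2S)).
by rewrite [h' * p]mulrC.
Qed.

End SumsOfSquares.

Definition order_ext (K E : realFieldType) (iota : {rmorphism K -> E}) : Prop :=
  {mono iota : x y / x <= y}.

Lemma order_extP (K E : realFieldType) (iota : {rmorphism K -> E}) :
  (forall x, 0 <= x -> 0 <= iota x) -> order_ext iota.
Proof.
move=> iota0; apply: le_mono => x y xy.
rewrite lt_neqAle (inj_eq (fmorph_inj iota)) (lt_eqF xy) /=.
by rewrite -subr_ge0 -rmorphB iota0 // subr_ge0 ltW.
Qed.

Section PolyPoint.
Variables (K : realFieldType) (alpha : sper {poly K}).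
Hypothesis alphaK : forall c : K, 0 <= c -> 0 <= sper_eval alpha c%:P.

Definition const_residue : {rmorphism K -> residue_field alpha} :=
  residue alpha \o polyC.

Lemma const_residue_ext : order_ext const_residue.
Proof. by apply: order_extP => c c0; rewrite /= residue_ge0 alphaK. Qed.

Lemma residue_horner p :
  residue alpha p = (map_poly const_residue p).[residue alpha 'X].
Proof.
elim/poly_ind: p => [|p c IH]; first by rewrite !rmorph0 horner0.
by rewrite !rmorphD !rmorphM /= map_polyX map_polyC hornerMXaddC -IH.
Qed.

End PolyPoint.

(** The root is the class of $X$ in the residue field of a prime cone containing $X-s$, $t-X$ and
    all multiples of [p]. It differs from [s] and [t] since [p] does not vanish there. *)
Lemma sign_change_root (K : realFieldType) (p : {poly K}) (s t : K) :
  s < t -> p.[s] * p.[t] < 0 ->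
  exists (E : realFieldType) (iota : {rmorphism K -> E}) (r : E),
    [/\ order_ext iota, iota s < r < iota t & root (map_poly iota p) r].
Proof.
move=> st pst.
pose u := 'X - s%:P; pose v := t%:P - 'X : {poly K}; pose w := (t - s)^-1.
have w0 : 0 < w by rewrite invr_gt0 subr_gt0.
have wts : w * (t - s) = 1 by rewrite mulVf // gt_eqF // subr_gt0.
pose T : set {poly K} := [set f | exists s1 s2 h,
  [/\ sos predT s1, sos predT s2 & f = s1 * u + s2 * v + p * h]].
(* Since $u+v=t-s$ is a positive constant with inverse $w$, both $1=w(u+v)$ and $uv=w(u^2v+v^2u)$
   lie in [T]. This is why [T], generated by [u] and [v] only, is closed under products. *)
have T_uv a b : sos predT a -> sos predT b -> T (a + b * (u * v)).
  move=> aS bS; have abS q : sos predT (w *: (a + b * (q * q))).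
    apply: sos_scale; first exact: ltW w0.
    by apply: sos_add => //; apply: sos_mul => //; exact: sos_sqr.
  exists (w *: (a + b * (v * v))), (w *: (a + b * (u * u))), 0.
  split=> //; apply: poly_funext => x; rewrite !hornerE /=.
  transitivity (w * (t - s) * (a.[x] + b.[x] * ((x - s) * (t - x)))).
    by rewrite wts; lra.
  lra.
have coneT : preorder_cone T.
  split.
  - move=> _ _ [a [b [h [aS bS ->]]]] [a' [b' [h' [aS' bS' ->]]]].
    exists (a + a'), (b + b'), (h + h'); split; do ?exact: sos_add.
    by apply: poly_funext => x; rewrite !hornerE /=; lra.
  - move=> _ _ [a [b [h [aS bS ->]]]] [a' [b' [h' [aS' bS' ->]]]].
    have [] := T_uv (a * a' * (u * u) + b * b' * (v * v)) (a * b' + a' * b).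
    + by apply: sos_add; apply: sos_mul; by [exact: sos_sqr | exact: sos_mul].
    + by apply: sos_add; exact: sos_mul.
    move=> a2 [b2 [h2 [aS2 bS2 e]]].
    exists a2, b2, (h2 + h * (a' * u + b' * v) + h' * (a * u + b * v + p * h)).
    split=> //; apply: poly_funext => x; move: (congr1 (horner^~ x) e).
    rewrite !hornerE /=; lra.
  - move=> f; rewrite -[_ * _]addr0 -(mul0r (u * v)).
    by apply: T_uv; [exact: sos_sqr | exact: sos0].
  - by move=> [s1 [s2 [h [s1S s2S]]]]; exact: sign_change_not_nonneg.
have [P coneP TP] := preorder_cone_prime coneT.
pose alpha := sper_of_cone coneP.
have TE f : T f -> 0 <= residue alpha f.
  by move=> /TP Pf; rewrite residue_ge0; apply/sper_of_cone_ge0.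
have S1 : sos predT (1 : {poly K}) by rewrite -(mulr1 1); exact: sos_sqr.
have alphaK (c : K) : 0 <= c -> 0 <= sper_eval alpha c%:P.
  move=> c0; rewrite -residue_ge0; apply: TE.
  rewrite -[_%:P]addr0 -(mul0r (u * v)); apply: T_uv; last exact: sos0.
  by rewrite -alg_polyC; exact: sos_scale.
have r0 : (map_poly (const_residue alpha) p).[residue alpha 'X] = 0.
  rewrite -residue_horner; apply/eqP; rewrite eq_le -oppr_ge0 -rmorphN /=.
  apply/andP; split; apply: TE.
    by exists 0, 0, (-1); rewrite !mul0r !add0r mulrN1; split=> //; exact: sos0.
  by exists 0, 0, 1; rewrite !mul0r !add0r mulr1; split=> //; exact: sos0.
have p_root (c : K) : const_residue alpha c = residue alpha 'X -> p.[c] = 0.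
  move=> cX; apply: (fmorph_inj (const_residue alpha)).
  by rewrite rmorph0 -horner_map cX.
have pNs : p.[s] != 0 by apply/eqP => p0; move: pst; rewrite p0 mul0r ltxx.
have pNt : p.[t] != 0 by apply/eqP => p0; move: pst; rewrite p0 mulr0 ltxx.
exists (residue_field alpha), (const_residue alpha), (residue alpha 'X).
split; [exact: const_residue_ext | | exact/eqP].
rewrite !lt_neqAle; apply/andP; split; apply/andP; split.
- by apply: contra_neq pNs => /p_root.
- rewrite -subr_ge0.
  have -> : residue alpha 'X - const_residue alpha s = residue alpha u.
    by rewrite /u rmorphB.
  apply: TE; by exists 1, 0, 0; rewrite mul1r mul0r mulr0 !addr0; split=> //; exact: sos0.
- by apply: contra_neq pNt => /esym/p_root.
- rewrite -subr_ge0.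
  have -> : const_residue alpha t - residue alpha 'X = residue alpha v.
    by rewrite /v rmorphB.
  apply: TE; by exists 0, 1, 0; rewrite mul1r mul0r mulr0 !addr0 add0r; split=> //; exact: sos0.
Qed.

(** * Compactness of an interval *)

Section Horner.
Variables (L E : realFieldType) (iota : {rmorphism L -> E}) (tau : E).

Definition eval_at : {poly L} -> E := fun p => (map_poly iota p).[tau].

Lemma eval_at_zmod : zmod_morphism eval_at.
Proof. by move=> p q; rewrite /eval_at rmorphB hornerD hornerN. Qed.
Lemma eval_at_monoid : monoid_morphism eval_at.
Proof.
by split=> [|p q]; rewrite /eval_at ?rmorph1 ?hornerC // rmorphM hornerM.
Qed.
HB.instance Definition _ :=
  GRing.isZmodMorphism.Build {poly L} E eval_at eval_at_zmod.
HB.instance Definition _ :=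
  GRing.isMonoidMorphism.Build {poly L} E eval_at eval_at_monoid.
End Horner.

Lemma ultra_or (T : Type) (U : set_system T) (A B : set T) : UltraFilter U ->
  U (A `|` B) -> U A \/ U B.
Proof.
move=> UU UAB; have [|UA] := in_ultra_setVsetC A UU; [by left|right].
by apply: filterS (filterI UAB UA) => x [[]].
Qed.

Section UltraPoint.
Variables (B : comNzRingType) (U : set_system (sper B)) (UU : UltraFilter U).

(** The limit of [U] in the constructible topology. An ultrafilter containing a union contains one
    of its two members, which transfers the totality and primality clauses. *)
Lemma ultra_cone :
  prime_cone [set f | U [set alpha | 0 <= sper_eval alpha f]].
Proof.
split=> /=.
- split=> /= [f g Uf Ug|f g Uf Ug|f|].
  + by apply: filterS (filterI Uf Ug) => a [/= ? ?]; rewrite rmorphD addr_ge0.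
  + by apply: filterS (filterI Uf Ug) => a [/= ? ?]; rewrite rmorphM mulr_ge0.
  + by apply: filterE => a /=; rewrite rmorphM -expr2 sqr_ge0.
  + move=> U1; apply: (filter_not_empty U); apply: filterS U1 => a /=.
    by rewrite rmorphN1 oppr_ge0 ler10.
- move=> f; apply: ultra_or; apply: filterE => a /=.
  by rewrite rmorphN oppr_ge0; apply/orP; exact: le_total.
- move=> f g Uf Ug.
  have UN0 h : U [set a | sper_eval a h = 0] ->
      U [set a | 0 <= sper_eval a h] /\ U [set a | 0 <= sper_eval a (- h)].
    move=> U0; split; apply: filterS U0 => a /= h0; first by rewrite h0.
    by rewrite rmorphN /= h0 oppr0.
  have : U ([set a | sper_eval a f = 0] `|` [set a | sper_eval a g = 0]).
    apply: filterS (filterI Uf Ug) => a [/=].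
    rewrite rmorphN oppr_ge0 /= rmorphM /= => fg fg'.
    have : (sper_eval a f == 0) || (sper_eval a g == 0).
      by rewrite -mulf_eq0 eq_le fg fg'.
    by case/orP => /eqP; [left|right].
  by case/ultra_or => /UN0; [left|right].
Qed.

End UltraPoint.

Section Compactness.
Variables (L : realFieldType) (b b' : L).

(* An element tau of an ordered extension of L encodes a point of the real
   spectrum of L[X] lying over the order of L. *)
Definition interval_property (P : forall E : realFieldType,
    {rmorphism L -> E} -> E -> Prop) : Prop :=
  forall (E : realFieldType) (iota : {rmorphism L -> E}) (tau : E),
    order_ext iota -> iota b <= tau <= iota b' -> P E iota tau.

Definition pos_at (gs : seq {poly L}) (E : realFieldType)
    (iota : {rmorphism L -> E}) (tau : E) : Prop :=
  forall g, g \in gs -> 0 < eval_at iota tau g.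

(** If no finite subfamily covered the interval, the sets of uncovered points would generate a
    proper filter. The limit of an ultrafilter refining it is again a point over $[b,b']$, seen in
    its residue field with [tau] the class of $X$; the member of [G] positive there is positive on a
    set of the ultrafilter, a contradiction. *)
Lemma interval_compact (G : set (seq {poly L})) :
  interval_property (fun E iota tau => exists2 gs, G gs & pos_at gs iota tau) ->
  exists2 Gs : seq (seq {poly L}), (forall gs, gs \in Gs -> G gs) &
    interval_property (fun E iota tau =>
      exists2 gs, gs \in Gs & pos_at gs iota tau).
Proof.
move=> covG; apply: contrapT => nGs.
pose X : set (sper {poly L}) := [set alpha |
  [/\ forall c : L, 0 <= c -> 0 <= sper_eval alpha c%:P,
      0 <= sper_eval alpha ('X - b%:P) & 0 <= sper_eval alpha (b'%:P - 'X)]].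
pose bad (Gs : seq (seq {poly L})) : set (sper {poly L}) :=
  X `&` [set alpha | forall gs, gs \in Gs ->
    ~ forall g, g \in gs -> 0 < sper_eval alpha g].
have bad0 Gs : (forall gs, gs \in Gs -> G gs) -> bad Gs !=set0.
  move=> GsG; apply: contrapT => bad0; apply: nGs; exists Gs => //.
  move=> E iota tau iotaE /andP[btau taub]; apply: contrapT => nex; apply: bad0.
  exists (sper_of (eval_at iota tau)).
  have ge0 f : (0 <= sper_eval (sper_of (eval_at iota tau)) f) =
      (0 <= eval_at iota tau f).
    by rewrite leNgt -oppr_gt0 -rmorphN sper_of_gt0 rmorphN oppr_gt0 -leNgt.
  split; first split.
  + move=> c c0; rewrite ge0 /= /eval_at map_polyC hornerC /=.
    by rewrite -(rmorph0 iota) iotaE.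
  + by rewrite ge0 rmorphB /= /eval_at map_polyC map_polyX hornerC hornerX subr_ge0.
  + by rewrite ge0 rmorphB /= /eval_at map_polyC map_polyX hornerC hornerX subr_ge0.
  move=> gs gsGs gsp; apply: nex; exists gs => // g /gsp.
  by rewrite sper_of_gt0.
pose F : set_system (sper {poly L}) :=
  [set Y | exists2 Gs, (forall gs, gs \in Gs -> G gs) & bad Gs `<=` Y].
have FF : ProperFilter F.
  split.
    by move=> [Gs /bad0[a ba] /(_ a ba)].
  split.
  - by exists [::].
  - move=> Y Z [Gs GsG GsY] [Hs HsG HsZ]; exists (Gs ++ Hs).
      by move=> gs; rewrite mem_cat => /orP[/GsG|/HsG].
    move=> a [Xa aGH]; split.
      by apply: GsY; split=> // gs gsGs; apply: aGH; rewrite mem_cat gsGs.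
    by apply: HsZ; split=> // gs gsHs; apply: aGH; rewrite mem_cat gsHs orbT.
  - by move=> Y Z YZ [Gs GsG GsY]; exists Gs => // a /GsY/YZ.
have [U [UU FU]] := ultraFilterLemma FF.
have UX : U X by apply: FU; exists [::] => // a [].
pose alpha := sper_of_cone (ultra_cone UU).
have alpha_ge0 f : U [set a | 0 <= sper_eval a f] -> 0 <= sper_eval alpha f.
  by move=> Uf; apply/sper_of_cone_ge0.
have alphaK (c : L) : 0 <= c -> 0 <= sper_eval alpha c%:P.
  by move=> c0; apply: alpha_ge0; apply: filterS UX => a [+ _ _]; apply.
have resE p : eval_at (const_residue alpha) (residue alpha 'X) p = residue alpha p.
  by rewrite [RHS]residue_horner.
have [] := covG _ (const_residue alpha) (residue alpha 'X) (const_residue_ext alphaK).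
  apply/andP; split; rewrite -subr_ge0.
    have -> : residue alpha 'X - const_residue alpha b = residue alpha ('X - b%:P).
      by rewrite rmorphB.
    by rewrite residue_ge0; apply: alpha_ge0; apply: filterS UX => a [].
  have -> : const_residue alpha b' - residue alpha 'X = residue alpha (b'%:P - 'X).
    by rewrite rmorphB.
  by rewrite residue_ge0; apply: alpha_ge0; apply: filterS UX => a [].
move=> gs Ggs gsp.
have Ugs : U [set a | forall g, g \in gs -> 0 < sper_eval a g].
  have : forall g, g \in gs -> U [set a | 0 < sper_eval a g].
    move=> g /gsp; rewrite resE residue_gt0 => /sper_of_cone_gt0 ngU.
    have [//|UC] := in_ultra_setVsetC [set a | 0 <= sper_eval a (- g)] UU.
    by apply: filterS UC => a /= /negP; rewrite rmorphN oppr_ge0 -ltNge.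
  elim: gs {Ggs gsp} => [|g gs IH] Ug; first by apply: filterE.
  have Ugs : U [set a | forall g, g \in gs -> 0 < sper_eval a g].
    by apply: IH => h hgs; apply: Ug; rewrite in_cons hgs orbT.
  apply: filterS (filterI (Ug g (mem_head _ _)) Ugs) => a [/= ag ags] h.
  by rewrite in_cons => /orP[/eqP ->|/ags].
have Ubad : U (bad [:: gs]).
  by apply: FU; exists [:: gs] => // hs; rewrite inE => /eqP ->.
apply: (filter_not_empty U); apply: filterS (filterI Ugs Ubad) => a [/= ags [_]].
by move=> /(_ gs (mem_head _ _)); apply.
Qed.

End Compactness.

(** Take an ordered extension in which [Q] has the largest possible number of distinct roots. A new
    root in a further extension would contradict maximality. *)
Lemma root_saturation (L : realFieldType) (Q : {poly L}) : Q != 0 ->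
  exists (E : realFieldType) (iota : {rmorphism L -> E}) (rs : seq E),
    order_ext iota /\
    forall (E' : realFieldType) (kappa : {rmorphism E -> E'}), order_ext kappa ->
      forall x : E', root (map_poly kappa (map_poly iota Q)) x ->
        x \in map kappa rs.
Proof.
move=> Q0.
pose P k := `[< exists (E : realFieldType) (iota : {rmorphism L -> E})
  (rs : seq E), [/\ order_ext iota, uniq rs, all (root (map_poly iota Q)) rs &
    size rs = k] >].
have P0 : exists k, P k.
  by exists 0%N; apply/asboolP; exists L, idfun, [::]; split.
have Pbound k : P k -> (k <= size Q)%N.
  move=> /asboolP[E [iota [rs [_ urs rrs <-]]]].
  have Q0' : map_poly iota Q != 0 by rewrite map_poly_eq0.
  by have := max_poly_roots Q0' rrs urs; rewrite size_map_poly => /ltnW.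
case: (ex_maxnP P0 Pbound) => k /asboolP[E [iota [rs [iotaE urs rrs rsk]]]] kmax.
exists E, iota, rs; split=> // E' kappa kappaE x Qx.
apply: contrapT => /negP xrs.
suff /kmax : P k.+1 by rewrite ltnn.
apply/asboolP; exists E', (kappa \o iota), (x :: map kappa rs); split.
- by move=> y z /=; rewrite kappaE iotaE.
- by rewrite /= xrs map_inj_uniq //; exact: fmorph_inj.
- rewrite /= map_poly_comp Qx; apply/allP => _ /mapP[y yrs ->].
  by rewrite fmorph_root (allP rrs).
- by rewrite /= size_map rsk.
Qed.

(** * Monomial curves *)

Section SperOpen.
Variable B : comNzRingType.
Implicit Types (d : sper B) (U V S : set (sper B)).

(** Topological indistinguishability; it replaces equality of [sper] records, whose orders live on
    different quotient types. *)
Definition same_signs d d' : Prop :=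
  forall f, (0 < sper_eval d f) = (0 < sper_eval d' f).

Lemma open_sper_basic U d : open U -> U d ->
  exists2 fs : seq B, sper_basic fs d & sper_basic fs `<=` U.
Proof.
move=> [D _ <-] [fs Dfs fsd]; exists fs => // d' fsd'; by exists fs.
Qed.

Lemma open_same_signs U d d' : open U -> same_signs d d' -> U d -> U d'.
Proof.
move=> oU dd' Ud; have [fs fsd fsU] := open_sper_basic oU Ud.
by apply: fsU => f /fsd; rewrite dd'.
Qed.

(** Inseparability inside [S], in a one-sided form that makes transitivity immediate and does not
    ask the points to be in [S]; symmetry does need this. *)
Definition linked S d d' : Prop :=
  forall U V, open U -> open V -> S `<=` U `|` V -> S `&` U `&` V `<=` set0 ->
    U d -> U d'.

Lemma linked_trans S d1 d2 d3 :
  linked S d1 d2 -> linked S d2 d3 -> linked S d1 d3.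
Proof. by move=> h12 h23 U V oU oV SUV SU0 /(h12 U V oU oV SUV SU0); exact: (h23 U V). Qed.

Lemma linked_sym S d d' : S d -> S d' -> linked S d d' -> linked S d' d.
Proof.
move=> Sd Sd' h U V oU oV SUV SU0 Ud'.
have [//|Vd] := SUV _ Sd; exfalso.
apply: (SU0 d'); split; first by split.
apply: (h V U) => //; first by rewrite setUC.
by rewrite setIAC.
Qed.

Lemma same_signs_linked S d d' : same_signs d d' -> linked S d d'.
Proof. by move=> dd' U V oU _ _ _; exact: open_same_signs. Qed.

Lemma linked_connected S : (forall d d', S d -> S d' -> linked S d d') ->
  connected S.
Proof.
move=> Slink C [d Cd] [U oU CU] [F cF CF]; rewrite CU.
apply/seteqP; split=> [x []//|x Sx]; split=> //.
have UF y : S y -> (U y <-> F y).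
  move=> Sy; split=> [Uy|Fy].
    by have [] : (S `&` F) y by rewrite -CF CU.
  by have [] : (S `&` U) y by rewrite -CU CF.
move: Cd; rewrite CU => -[Sd Ud].
(* [connected] speaks of a subset both relatively open and relatively closed; the complement of the
   closed witness is the second open set. *)
apply: (Slink d x Sd Sx U (~` F) oU (closed_openC cF)) Ud => y.
  move=> Sy; have [Fy|nFy] := pselect (F y); last by right.
  by left; apply/UF.
by move=> [[Sy /(UF y Sy) Fy]].
Qed.

End SperOpen.

(** * Points given by coordinates, and their behaviour along a monomial curve *)

Section Points.
Variables (R : comNzRingType) (n : nat).
Local Notation A := {mpoly R[n]}.

Definition pt (E : realFieldType) (rho : {rmorphism R -> E}) (x : 'I_n -> E) :
  sper A := sper_of (mmap rho x).

Lemma pt_gt0 (E : realFieldType) (rho : {rmorphism R -> E}) (x : 'I_n -> E) f :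
  (0 < sper_eval (pt rho x) f) = (0 < mmap rho x f).
Proof. exact: sper_of_gt0. Qed.

Lemma mmap_ext (L E : realFieldType) (rho : {rmorphism R -> L})
    (iota : {rmorphism L -> E}) (x : 'I_n -> L) (y : 'I_n -> E) f :
  (forall i, y i = iota (x i)) -> mmap (iota \o rho) y f = iota (mmap rho x f).
Proof.
move=> yx; rewrite /mmap rmorph_sum; apply: eq_bigr => m _.
rewrite rmorphM; congr (_ * _); rewrite /mmap1 rmorph_prod.
by apply: eq_bigr => i _; rewrite yx rmorphXn.
Qed.

Lemma pt_ext (L E : realFieldType) (rho : {rmorphism R -> L})
    (iota : {rmorphism L -> E}) (x : 'I_n -> L) (y : 'I_n -> E) :
  order_ext iota -> (forall i, y i = iota (x i)) ->
  same_signs (pt rho x) (pt (iota \o rho) y).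
Proof.
move=> iotaE yx f; rewrite [LHS]pt_gt0 [RHS]pt_gt0 (mmap_ext _ _ yx).
by rewrite -(rmorph0 iota) (leW_mono iotaE).
Qed.

Lemma mpoly_closed (P : A -> Prop) :
  (forall c, P c%:MP) -> (forall i, P 'X_i) ->
  (forall f g, P f -> P g -> P (f + g)) ->
  (forall f g, P f -> P g -> P (f * g)) -> forall f, P f.
Proof.
move=> PC PX PD PM; apply: mpolyind => [|c m p _ _ Pp]; first by rewrite -mpolyC0.
apply: PD => //; rewrite -mul_mpolyC; apply: (PM) => //.
rewrite mpolyXE_id; apply: big_ind => //; first by rewrite -mpolyC1.
move=> i _; elim: (m i) => [|k IH]; first by rewrite expr0 -mpolyC1.
by rewrite exprS; apply: PM.
Qed.

Section MonomialCurve.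
Variables (L : realFieldType) (rho : {rmorphism R -> L}).
Variables (c : 'I_n -> L) (e : 'I_n -> int).

Definition curve (E : realFieldType) (iota : {rmorphism L -> E}) (tau : E) :
    'I_n -> E :=
  fun i => iota (c i) * tau ^ e i.

(** The power [tau ^+ N] clears the negative exponents without changing the sign. [F] and [N] are
    chosen before the extension, so that one polynomial over [L] governs the sign of [f] on the
    whole curve. *)
Lemma curve_poly f : exists (F : {poly L}) (N : nat),
  forall (E : realFieldType) (iota : {rmorphism L -> E}) (tau : E), 0 < tau ->
    mmap (iota \o rho) (curve iota tau) f * tau ^+ N = eval_at iota tau F.
Proof.
elim/mpoly_closed: f => [a|i|f g|f g].
- exists (rho a)%:P, 0%N => E iota tau _.
  by rewrite mmapC expr0 mulr1 /eval_at map_polyC hornerC.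
- have [k [N eN]] : exists k N : nat, forall (E : realFieldType) (tau : E),
      0 < tau -> tau ^ e i * tau ^+ N = tau ^+ k.
    case: (e i) => k.
      by exists k, 0%N => E tau _; rewrite expr0 mulr1.
    exists 0%N, k.+1 => E tau t0.
    by rewrite NegzE -exprnN mulVf // expf_neq0 // gt_eqF.
  exists ((c i)%:P * 'X^k), N => E iota tau t0.
  rewrite mmapX mmap1U /curve -mulrA eN // /eval_at rmorphM hornerM /=.
  by rewrite map_polyC map_polyXn hornerC hornerXn.
- move=> [F [N FN]] [G [M GM]].
  exists (F * 'X^M + G * 'X^N), (N + M)%N => E iota tau t0.
  rewrite rmorphD rmorphD !rmorphM /= -(FN _ iota tau t0) -(GM _ iota tau t0).
  rewrite /eval_at !map_polyXn !hornerXn mulrDl exprD !mulrA; congr (_ + _).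
  by rewrite mulrAC.
- move=> [F [N FN]] [G [M GM]]; exists (F * G), (N + M)%N => E iota tau t0.
  rewrite !rmorphM /= -(FN _ iota tau t0) -(GM _ iota tau t0).
  by rewrite exprD mulrACA.
Qed.

Variables (b b' : L) (S : set (sper A)).
Hypothesis b0 : 0 < b.
Hypothesis curveS : interval_property b b' (fun E iota tau =>
  S (pt (iota \o rho) (curve iota tau))).

(* By compactness finitely many basic open sets, each on one side of the
   separation, cover the curve. After adjoining enough roots of the finitely
   many polynomials occurring in them, all the signs are constant between
   consecutive roots. *)
Lemma curve_side (U V : set (sper A)) (s t : L) : b <= s <= b' -> b <= t <= b' ->
  open U -> open V -> S `<=` U `|` V -> S `&` U `&` V `<=` set0 ->
  U (pt rho (curve idfun s)) -> U (pt rho (curve idfun t)).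
Proof.
move=> sb tb oU oV SUV SUV0.
have UVex : forall d, S d -> U d -> V d -> False.
  by move=> d Sd Ud Vd; apply: (SUV0 d).
pose Fp f : {poly L} := projT1 (cid (curve_poly f)).
have Fpos (E : realFieldType) (iota : {rmorphism L -> E}) (tau : E) f :
    0 < tau -> (0 < eval_at iota tau (Fp f)) =
      (0 < sper_eval (pt (iota \o rho) (curve iota tau)) f).
  move=> t0; rewrite /Fp; case: cid => /= F [N FN].
  by rewrite -(FN _ iota tau t0) pt_gt0 pmulr_lgt0 // exprn_gt0.
have tau_gt0 (E : realFieldType) (iota : {rmorphism L -> E}) (tau : E) :
    order_ext iota -> iota b <= tau -> 0 < tau.
  move=> iotaE; apply: lt_le_trans.
  by rewrite -(rmorph0 iota) (leW_mono iotaE).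
pose side fs := (S `&` sper_basic fs `<=` U) \/ (S `&` sper_basic fs `<=` V).
pose G : set (seq {poly L}) := [set map Fp fs | fs in side].
have covG : interval_property b b' (fun E iota tau =>
    exists2 gs, G gs & pos_at gs iota tau).
  move=> E iota tau iotaE taub; have Sd := curveS iotaE taub.
  have t0 : 0 < tau by case/andP: taub => /(tau_gt0 _ _ _ iotaE).
  have [Ud|Vd] := SUV _ Sd.
    have [fs fsd fsU] := open_sper_basic oU Ud.
    exists (map Fp fs); first by exists fs => //; left=> d [_ /fsU].
    by move=> _ /mapP[f ffs ->]; rewrite Fpos //; exact: fsd.
  have [fs fsd fsV] := open_sper_basic oV Vd.
  exists (map Fp fs); first by exists fs => //; right=> d [_ /fsV].
  by move=> _ /mapP[f ffs ->]; rewrite Fpos //; exact: fsd.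
have [Gs GsG covGs] := interval_compact covG.
pose Q := \prod_(g <- flatten Gs | g != 0) g.
have Q0 : Q != 0 by rewrite prodf_seq_neq0; apply/allP => g _; apply/implyP.
have [E [iota [rs [iotaE rsP]]]] := root_saturation Q0.
pose Ut (tau : E) := U (pt (iota \o rho) (curve iota tau)).
pose inb (tau : E) := iota b <= tau <= iota b'.
(* beta is allowed to be a root, gamma is not *)
have step (beta gamma : E) : inb beta -> inb gamma ->
    (forall (E' : realFieldType) (kappa : {rmorphism E -> E'}) r,
      order_ext kappa ->
      Num.min (kappa beta) (kappa gamma) < r < Num.max (kappa beta) (kappa gamma)
        \/ r = kappa gamma ->
      r \notin map kappa rs) ->
    (Ut beta <-> Ut gamma).
  move=> betab gammab nor.
  have beta0 : 0 < beta by case/andP: betab => /(tau_gt0 _ _ _ iotaE).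
  have gamma0 : 0 < gamma by case/andP: gammab => /(tau_gt0 _ _ _ iotaE).
  have [gs gsGs gsp] := covGs _ iota beta iotaE betab.
  have gsp' : pos_at gs iota gamma.
    move=> g ggs; have gb := gsp g ggs.
    have g0 : g != 0 by apply/eqP => g0; move: gb; rewrite g0 rmorph0 ltxx.
    have gflat : g \in flatten Gs by apply/flattenP; exists gs.
    (* Saturation at work: a sign change of [g] yields a root only in some further extension [E'],
       but that root comes from the list [rs] in [E]. *)
    have Qroot (E' : realFieldType) (kappa : {rmorphism E -> E'}) r :
        order_ext kappa -> root (map_poly kappa (map_poly iota g)) r ->
        r \in map kappa rs.
      move=> kappaE gr; apply: rsP => //.
      rewrite /Q (big_rem g) //= g0 !rmorphM rootM gr //.
    rewrite ltNge; apply/negP => gg.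
    have {}gg : eval_at iota gamma g < 0.
      rewrite lt_neqAle gg andbT; apply/eqP => gg0.
      have := Qroot E idfun gamma (fun _ _ => erefl).
      rewrite map_poly_id // => /(_ (introT eqP gg0)).
      by apply/negP; apply: nor => //; right.
    have gbg : (map_poly iota g).[beta] * (map_poly iota g).[gamma] < 0.
      by rewrite pmulr_rlt0.
    have [bg|gb'|be] := ltgtP beta gamma; last by move: gb gg; rewrite be; lra.
      have [E' [kappa [r [kappaE bgr gr]]]] := sign_change_root bg gbg.
      suff : r \notin map kappa rs by rewrite (Qroot E' kappa r kappaE gr).
      apply: nor => //; left; by rewrite minEle maxEle kappaE ltW.
    rewrite mulrC in gbg.
    have [E' [kappa [r [kappaE bgr gr]]]] := sign_change_root gb' gbg.
    suff : r \notin map kappa rs by rewrite (Qroot E' kappa r kappaE gr).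
    apply: nor => //; left; by rewrite minC maxC minEle maxEle kappaE ltW.
  have [fs fsside fsgs] := GsG _ gsGs.
  have fsb : sper_basic fs (pt (iota \o rho) (curve iota beta)).
    by move=> f ffs; rewrite -Fpos //; apply: gsp; rewrite -fsgs map_f.
  have fsg : sper_basic fs (pt (iota \o rho) (curve iota gamma)).
    by move=> f ffs; rewrite -Fpos //; apply: gsp'; rewrite -fsgs map_f.
  have Sb := curveS iotaE betab; have Sg := curveS iotaE gammab.
  case: fsside => fsW; split=> Ud; do ?[by apply: fsW].
    by exfalso; apply: (UVex _ Sb Ud); exact: fsW.
  by exfalso; apply: (UVex _ Sg Ud); exact: fsW.
have main k : forall beta gamma : E, inb beta -> inb gamma -> beta <= gamma ->
    (count (fun r => (beta < r < gamma)%R) rs <= k)%N -> (Ut beta <-> Ut gamma).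
  elim: k => [|k IH] beta gamma betab gammab bg cnt.
    have [->//|bneg] := eqVneq beta gamma.
    have {bneg}bg' : beta < gamma by rewrite lt_neqAle bneg.
    have nr r : r \in rs -> ~~ (beta < r < gamma).
      move=> rrs; apply/negP => rbg.
      move: cnt; rewrite leqNgt -has_count => /hasPn /(_ r rrs) /=.
      by rewrite rbg.
    (* Both ends may be roots, whereas [step] excludes this for its second argument. The midpoint is
       not a root, so each end is compared with it. *)
    set mu := (beta + gamma) / 2%:R.
    have bmu : beta < mu by rewrite /mu; lra.
    have mug : mu < gamma by rewrite /mu; lra.
    have mub : inb mu.
      case/andP: betab => b1 b2; case/andP: gammab => g1 g2.
      by apply/andP; split; lra.
    have nr' (E' : realFieldType) (kappa : {rmorphism E -> E'}) r :
        order_ext kappa -> kappa beta < r < kappa gamma -> r \notin map kappa rs.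
      move=> kappaE rbg; apply/negP => /mapP[r0 r0rs re].
      by move: rbg; rewrite re !(leW_mono kappaE); apply/negP/nr.
    transitivity (Ut mu).
      apply: step => // E' kappa r kappaE.
      have kbmu : kappa beta < kappa mu by rewrite (leW_mono kappaE).
      have kmug : kappa mu < kappa gamma by rewrite (leW_mono kappaE).
      rewrite minEle maxEle (ltW kbmu) => h; apply: nr' => //.
      by case: h => [/andP[h1 h2]|->]; apply/andP; split=> //; apply: lt_trans kmug.
    symmetry; apply: step => // E' kappa r kappaE.
    have kbmu : kappa beta < kappa mu by rewrite (leW_mono kappaE).
    have kmug : kappa mu < kappa gamma by rewrite (leW_mono kappaE).
    rewrite minC maxC minEle maxEle (ltW kmug) => h; apply: nr' => //.
    by case: h => [/andP[h1 h2]|->]; apply/andP; split=> //; apply: (lt_trans kbmu).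
  have [/hasP[r rrs /andP[br rg]]|/hasPn nr] :=
      boolP (has (fun r => beta < r < gamma) rs); last first.
    apply: IH => //; apply: (@leq_trans 0) => //.
    by rewrite leqNgt -has_count; apply/hasPn.
  have rb : inb r.
    case/andP: betab => b1 b2; case/andP: gammab => g1 g2.
    by apply/andP; split; lra.
  have cnt_lt (p q : pred E) : {subset p <= q} -> q r -> ~~ p r ->
      (count p rs < count q rs)%N.
    move=> pq qr pr; rewrite !(permP (perm_to_rem rrs)) /= qr (negbTE pr).
    by rewrite add0n add1n ltnS; apply: sub_count.
  transitivity (Ut r).
    apply: IH => //; first exact: ltW.
    rewrite -ltnS (leq_trans _ cnt) // cnt_lt ?br ?rg ?ltxx ?andbF //.
    by move=> x /andP[h1 h2]; apply/andP; split=> //; exact: lt_trans rg.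
  apply: IH => //; first exact: ltW.
  rewrite -ltnS (leq_trans _ cnt) // cnt_lt ?br ?rg ?ltxx //.
  by move=> x /andP[h1 h2]; apply/andP; split=> //; exact: lt_trans h1.
have inbE (x : L) : b <= x <= b' -> inb (iota x).
  by rewrite /inb !iotaE.
have ptE (x : L) : same_signs (pt rho (curve idfun x))
    (pt (iota \o rho) (curve iota (iota x))).
  by apply: pt_ext => // i; rewrite /curve /= rmorphM fmorphXz.
move=> Us; apply: (open_same_signs oU (fun f => esym (ptE t f))).
have {}Us : Ut (iota s) by apply: open_same_signs Us.
have [st|ts] := leP s t.
  by apply/(main _ _ _ (inbE _ sb) (inbE _ tb) _ (leqnn _)); rewrite ?iotaE.
apply/(main _ _ _ (inbE _ tb) (inbE _ sb) _ (leqnn _)) => //.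
by rewrite iotaE ltW.
Qed.

Lemma curve_linked (s t : L) : b <= s <= b' -> b <= t <= b' ->
  linked S (pt rho (curve idfun s)) (pt rho (curve idfun t)).
Proof. by move=> sb tb U V; exact: curve_side. Qed.

End MonomialCurve.
End Points.

(** * Rational combinations of values *)

Lemma denq_dvd_mul (q : rat) (M : nat) : (`|denq q| %| M)%N ->
  M%:R * q = (numq (M%:R * q))%:~R.
Proof.
move=> /dvdnP[k ->].
have -> : (k * `|denq q|)%:R * q = (k%:Z * numq q)%:~R :> rat.
  rewrite -{2}[q]divq_num_den natrM intrM -!mulrA; congr (_ * _).
  rewrite mulrCA -[`|denq q|%:R]/(`|denq q|%N%:Z%:~R) gez0_abs ?denq_ge0 //.
  by rewrite mulfV ?mulr1 // intr_eq0 denq_eq0.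
by rewrite numq_int.
Qed.

Lemma common_denominator (I : finType) (c : I -> rat) :
  exists (N : nat) (k : I -> int), (0 < N)%N /\ forall i, N%:R * c i = (k i)%:~R.
Proof.
exists (\prod_i `|denq (c i)|)%N.
exists (fun i => numq ((\prod_i `|denq (c i)|)%N%:R * c i)); split.
  by apply: prodn_gt0 => i; rewrite absz_gt0 denq_neq0.
by move=> i; apply: denq_dvd_mul; rewrite (bigD1 i) //= dvdn_mulr.
Qed.

Section TensorTheory.
Variables (U V : zmodType).
Implicit Types (u : U) (v : V).

Let tens_rel0 (r : {freeg (U * V)}) : tensor_rel r -> \pi_(tensor U V) r = 0.
Proof.
move=> rel; apply/eqP; rewrite -[0](raddf0 (\pi_(tensor U V))) -Quotient.idealrBE subr0.
by apply/asboolP => S _; apply.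
Qed.

Lemma tensDl u u' v : tens (u + u') v = tens u v + tens u' v.
Proof.
apply/eqP; rewrite -subr_eq0 opprD addrA /tens; apply/eqP.
by rewrite -[RHS](tens_rel0 (TensorDl u u' v)) !raddfB.
Qed.

Lemma tensDr u v v' : tens u (v + v') = tens u v + tens u v'.
Proof.
apply/eqP; rewrite -subr_eq0 opprD addrA /tens; apply/eqP.
by rewrite -[RHS](tens_rel0 (TensorDr u v v')) !raddfB.
Qed.

Definition tensl v u : tensor U V := tens u v.

Lemma tensl_zmod v : zmod_morphism (tensl v).
Proof.
by move=> u u'; apply/eqP; rewrite eq_sym subr_eq /tensl -tensDl subrK.
Qed.

Lemma tensr_zmod u : zmod_morphism (@tens U V u).
Proof. by move=> v v'; apply/eqP; rewrite eq_sym subr_eq -tensDr subrK. Qed.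

HB.instance Definition _ v :=
  GRing.isZmodMorphism.Build U (tensor U V) (tensl v) (tensl_zmod v).
HB.instance Definition _ u :=
  GRing.isZmodMorphism.Build V (tensor U V) (tens u) (tensr_zmod u).

Lemma tensMz u v (k : int) : tens (u *~ k) v = tens u (v *~ k).
Proof. by rewrite (raddfMz (@tens U V u)) -[tens (u *~ k) v]/(tensl v (u *~ k)) (raddfMz (tensl v)). Qed.

End TensorTheory.

Section TensorRat.
Variable G : zmodType.
Hypothesis G_torsion_free : forall (g : G) (m : nat), (0 < m)%N -> g *+ m = 0 -> g = 0.

(* Clearing the denominators of a formal sum by a large enough multiple M. *)
Let clear (M : nat) (D : {freeg (G * rat)}) : zmodule G :=
  fglift (fun z : G * rat => (z.1 *~ numq (M%:R * z.2) : zmodule G)) D.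

Let clearB M (D D' : {freeg (G * rat)}) : clear M (D - D') = clear M D - clear M D'.
Proof. exact: lift_is_additive. Qed.

Let clearU M g q : clear M <<(g, q)>> = g *~ numq (M%:R * q).
Proof. by rewrite /clear liftU scale1r. Qed.

(** Injectivity of $G\to G\otimes\mathbb{Q}$. The map [clear M] is additive in the rational argument
    once [M] is a multiple of the denominators involved; so the formal sums killed by [clear M] for
    every positive multiple [M] of some [N] form a subgroup containing the tensor relations. *)
Lemma tens1_eq0 (g : G) : tens g (1 : rat) = 0 -> g = 0.
Proof.
move/eqP; rewrite -[0](raddf0 (\pi_(tensor G rat))) /tens -Quotient.idealrBE subr0.
pose S : {pred {freeg (G * rat)}} := fun D =>
  `[< exists2 N, (0 < N)%N & forall M, (0 < M)%N -> (N %| M)%N -> clear M D = 0 >].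
move=> /asboolP/(_ S) gS; have {gS} : <<(g, 1 : rat)>> \in S; last first.
  move=> /asboolP[N N0 /(_ N N0 (dvdnn _))].
  rewrite clearU mulr1 -[N%:R]/(N%:Z%:~R) numq_int.
  exact: G_torsion_free.
apply: gS.
- split.
    by apply/asboolP; exists 1%N => // M _ _; rewrite -(subrr 0) clearB subrr.
  move=> D D' /asboolP[N N0 DN] /asboolP[N' N'0 DN'].
  apply/asboolP; exists (N * N')%N; first by rewrite muln_gt0 N0.
  move=> M M0 NM; rewrite clearB DN ?DN' ?subr0 //; first exact: dvdn_trans (dvdn_mull _ _) NM.
  exact: dvdn_trans (dvdn_mulr _ _) NM.
- move=> _ [u u' q|u q q']; apply/asboolP.
    exists 1%N => // M _ _; rewrite !clearB !clearU.
    by rewrite mulrzDl addrAC addrK subrr.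
  exists (`|denq q| * `|denq q'|)%N.
    by rewrite muln_gt0 !absz_gt0 !denq_neq0.
  move=> M _ qqM; rewrite !clearB !clearU.
  have -> : numq (M%:R * (q + q')) = numq (M%:R * q) + numq (M%:R * q').
    rewrite mulrDr [M%:R * q]denq_dvd_mul ?(dvdn_trans _ qqM) ?dvdn_mulr //.
    rewrite [M%:R * q']denq_dvd_mul ?(dvdn_trans _ qqM) ?dvdn_mull //.
    by rewrite -rmorphD !numq_int.
  by rewrite mulrzDr addrAC addrK subrr.
Qed.

Variables (I : finType) (g : I -> G) (q : I -> rat) (N : nat) (m : I -> int).
Hypotheses (N_gt0 : (0 < N)%N) (Nq : forall i, N%:R * q i = (m i)%:~R).

Lemma tens_sumM : (\sum_i tens (g i) (q i)) *+ N = tens (\sum_i g i *~ m i) 1.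
Proof.
rewrite -sumrMnl -[RHS]/(tensl 1 _) (raddf_sum (tensl (1 : rat))) /=; apply: eq_bigr => i _.
by rewrite -(raddfMn (tens (g i))) /= -mulr_natl Nq /tensl tensMz.
Qed.

Lemma tens_sum_eq0 : \sum_i tens (g i) (q i) = 0 <-> \sum_i g i *~ m i = 0.
Proof.
split=> [t0|g0].
  by apply: tens1_eq0; rewrite -tens_sumM t0 mul0rn.
have -> : \sum_i tens (g i) (q i) = tens (\sum_i g i *~ m i) N%:R^-1.
  rewrite -[RHS]/(tensl _ _) (raddf_sum (tensl N%:R^-1)) /=; apply: eq_bigr => i _.
  rewrite /tensl tensMz; congr tens; rewrite -mulrzl -Nq mulrAC mulfV ?mul1r //.
  by rewrite pnatr_eq0 -lt0n.
by rewrite g0 -[LHS]/(tensl _ _) raddf0.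
Qed.

End TensorRat.

(** * Torsion and order in the value group *)

Section ValGroup.
Variable D : realDomainType.
Local Notation F := {fraction D}.
Implicit Types (x y : units_add F).

Lemma val_ring_le (a b : F) : `|a| <= `|b| -> b \in @val_ring D -> a \in @val_ring D.
Proof. by move=> ab /asboolP[z bz]; apply/asboolP; exists z; exact: le_trans bz. Qed.

(** If $|a|>1$ then $|a|\le|a|^m$, and the ring is convex. Torsion-freeness of the value group
    follows. *)
Lemma val_ring_root (a : F) (m : nat) : (0 < m)%N ->
  a ^+ m \in @val_ring D -> a \in @val_ring D.
Proof.
move=> m0 am; have [a1|a1] := leP `|a| 1.
  by apply: val_ring_le (val_ring1 D); rewrite normr1.
apply: val_ring_le am; rewrite normrX -{1}[`|a|]expr1.
by rewrite ler_eXn2l.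
Qed.

Lemma val_class_ge0 x : (0 <= val_class x) <-> val x \in @val_ring D.
Proof.
split=> [/asboolP[y [yR]]|xR]; last by apply/asboolP; exists x; rewrite subr0.
rewrite subr0 => /eqP; rewrite val_class_eq => /andP[/= xyR _].
have -> : val x = val x / val y * val y by rewrite mulfVK // (valP y).
exact: val_ringM.
Qed.

Lemma val_class_eq0 x : (val_class x == 0) = (x \in @val_units D).
Proof. by rewrite -(raddf0 (@val_class D)) val_class_eq subr0. Qed.

Lemma val_class_gt0 x : (0 < val_class x) <-> (val x)^-1 \notin @val_ring D.
Proof.
rewrite lt_def val_class_eq0; split=> [/andP[xU /val_class_ge0 xR]|xVR].
  by apply: contra xU => xVR; rewrite unfold_in; apply/andP.
have [xR|] := @val_ring_total D (val x) (valP x); last by rewrite (negbTE xVR).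
apply/andP; split; last exact/val_class_ge0.
by rewrite unfold_in negb_and xVR orbT.
Qed.

Lemma val_unitsMn x (m : nat) : val (x *+ m) = val x ^+ m.
Proof. by elim: m => [|m IH]; rewrite ?mulr0n ?expr0 // mulrS exprS -IH. Qed.

Lemma val_unitsMz x (k : int) : val (x *~ k) = val x ^ k.
Proof.
by case: k => m; rewrite ?NegzE ?mulrNz -?pmulrn /= -?exprnN val_unitsMn.
Qed.

Lemma val_units_sum (I : finType) (x : I -> units_add F) (k : I -> int) :
  val (\sum_i x i *~ k i) = \prod_i val (x i) ^ k i.
Proof.
apply: (big_ind2 (fun (a : units_add F) (b : F) => val a = b)) => //.
- by move=> a _ b _ <- <-.
- by move=> i _; exact: val_unitsMz.
Qed.

Lemma val_group_torsion_free (g : val_group D) (m : nat) :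
  (0 < m)%N -> g *+ m = 0 -> g = 0.
Proof.
move=> m0; rewrite -[g]val_classK -raddfMn => /eqP.
rewrite val_class_eq0 => /andP[] /=; rewrite val_unitsMn -exprVn.
move=> /(val_ring_root m0) xR /(val_ring_root m0) xVR.
by apply/eqP; rewrite val_class_eq0 unfold_in; apply/andP.
Qed.

Lemma val_group_mulrn_gt0 (g : val_group D) (m : nat) :
  (0 < m)%N -> (0 < g *+ m) = (0 < g).
Proof.
move=> m0; rewrite -[g]val_classK -raddfMn; apply/idP/idP.
  move=> /val_class_gt0; rewrite val_unitsMn -exprVn => xR; apply/val_class_gt0.
  apply: contra xR; elim: m {m0} => [|m IH] xR; first exact: val_ring1.
  by rewrite exprS; apply: val_ringM => //; exact: IH.
move=> /val_class_gt0 xR; apply/val_class_gt0.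
by rewrite val_unitsMn -exprVn; apply: contra xR; exact: val_ring_root.
Qed.

(** Let $t$ be the sum. Both $Nt$ and, if $t>0$, some $Mt$ come from elements of the group;
    injectivity of $g\mapsto g\otimes1$ identifies $M$ times the first element with $N$ times the
    second. *)
Lemma tensQ_sum_gt0 (I : finType) (g : I -> val_group D) (q : I -> rat)
    (N : nat) (m : I -> int) : (0 < N)%N -> (forall i, N%:R * q i = (m i)%:~R) ->
  tensQ_gt0 (\sum_i tens (g i) (q i)) <-> 0 < \sum_i g i *~ m i.
Proof.
move=> N0 Nq; split=> [[M [h [M0 h0 tM]]]|g0]; last first.
  by exists N, (\sum_i g i *~ m i); split=> //; exact: tens_sumM.
suff e : (\sum_i g i *~ m i) *+ M = h *+ N.
  by rewrite -(val_group_mulrn_gt0 _ M0) e val_group_mulrn_gt0.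
apply/eqP; rewrite -subr_eq0; apply/eqP.
apply: (tens1_eq0 val_group_torsion_free).
rewrite -[LHS]/(tensl _ _) raddfB !raddfMn /= /tensl -(tens_sumM _ Nq) -tM.
by rewrite mulrnAC mulNrn subrr.
Qed.

End ValGroup.

(** * Convex subrings and monomials *)

Definition convex_subring (E : realFieldType) (O : set E) : Prop :=
  [/\ O 1, forall a b, O a -> O b -> O (a + b),
      forall a b, O a -> O b -> O (a * b) &
      forall a b, `|a| <= `|b| -> O b -> O a].

(** For [phi] the residue map of a point this is the valuation ring of that point. A general [phi]
    allows [E] to be larger than the residue field. *)
Definition hull (B : comNzRingType) (E : realFieldType) (phi : B -> E) : set E :=
  [set y | exists z, `|y| <= phi z].

Lemma hull_convex (B : comNzRingType) (E : realFieldType)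
  (phi : {rmorphism B -> E}) : convex_subring (hull phi).
Proof.
split.
- by exists 1; rewrite normr1 rmorph1.
- move=> a b [z az] [w bw]; exists (z + w).
  by rewrite rmorphD (le_trans (ler_normD _ _)) // lerD.
- by move=> a b [z az] [w bw]; exists (z * w); rewrite normrM rmorphM ler_pM.
- by move=> a b ab [z bz]; exists z; exact: le_trans bz.
Qed.

Section ConvexSubring.
Variables (E : realFieldType) (O : set E).
Hypothesis convO : convex_subring O.

Lemma convex1 : O 1. Proof. by case: convO. Qed.
Lemma convexD a b : O a -> O b -> O (a + b). Proof. by case: convO => _ + _ _; apply. Qed.
Lemma convexM a b : O a -> O b -> O (a * b). Proof. by case: convO => _ _ + _; apply. Qed.
Lemma convex_le a b : `|a| <= `|b| -> O b -> O a. Proof. by case: convO => _ _ _; apply. Qed.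

Lemma convex_le_pos a b : 0 < a -> a <= b -> O b -> O a.
Proof.
by move=> a0 ab; apply: convex_le; rewrite !gtr0_norm // (lt_le_trans a0).
Qed.

Lemma convex_le1 a : 0 < a -> a <= 1 -> O a.
Proof. by move=> a0 a1; apply: convex_le_pos a1 convex1. Qed.

Lemma convexX a k : O a -> O (a ^+ k).
Proof.
move=> aO; elim: k => [|k IH]; first by rewrite expr0; exact: convex1.
by rewrite exprS; exact: convexM.
Qed.

Lemma convex_root a k : (0 < k)%N -> O (a ^+ k) -> O a.
Proof.
move=> k0; have [a1|a1] := leP `|a| 1.
  by move=> _; apply: convex_le convex1; rewrite normr1.
by apply: convex_le; rewrite normrX -{1}[`|a|]expr1 ler_eXn2l.
Qed.

Definition convex_unit a := O a /\ O a^-1.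

Lemma convex_unit1 : convex_unit 1.
Proof. by split; rewrite ?invr1; exact: convex1. Qed.

Lemma convex_unitM a b : convex_unit a -> convex_unit b -> convex_unit (a * b).
Proof. by move=> [? ?] [? ?]; split; rewrite ?invfM; exact: convexM. Qed.

Lemma convex_unitV a : convex_unit a -> convex_unit a^-1.
Proof. by move=> [? ?]; split; rewrite ?invrK. Qed.

Lemma convex_unitXz a (k : int) : convex_unit a -> convex_unit (a ^ k).
Proof.
have unitXn b m : convex_unit b -> convex_unit (b ^+ m).
  by move=> [? ?]; split; rewrite -?exprVn; exact: convexX.
move=> aU; case: k => m; first exact: unitXn.
by rewrite NegzE -exprnN; apply/convex_unitV/unitXn.
Qed.

Lemma convex_unit_root a (k : int) : k != 0 -> convex_unit (a ^ k) -> convex_unit a.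
Proof.
have rootXn m : (0 < m)%N -> convex_unit (a ^+ m) -> convex_unit a.
  by move=> m0 []; rewrite -exprVn => *; split; apply: (convex_root m0).
case: k => m k0; first by apply: rootXn; case: m k0.
rewrite NegzE -exprnN => /convex_unitV; rewrite invrK.
exact: rootXn.
Qed.

Lemma convex_unit_between a t : 0 < t -> convex_unit a -> 0 < a ->
  (a <= t <= 1) || (1 <= t <= a) -> convex_unit t.
Proof.
move=> t0 [aO aVO] a0 /orP[/andP[at_ t1]|/andP[t1 ta]]; split.
- exact: convex_le1.
- by apply: convex_le_pos aVO; rewrite ?invr_gt0 // lef_pV2 ?posrE.
- exact: convex_le_pos aO.
- by apply: convex_le1; rewrite ?invr_gt0 // invf_le1.
Qed.

End ConvexSubring.

Section Monomials.
Variables (n : nat) (E : realFieldType).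
Implicit Types (x y : 'I_n -> E) (k : 'I_n -> int).

Definition mon x k : E := \prod_i x i ^ k i.

Lemma mon_gt0 x k : (forall i, 0 < x i) -> 0 < mon x k.
Proof. by move=> x0; apply: prodr_gt0 => i _; rewrite exprz_gt0. Qed.

Lemma monM x y k : mon (fun i => x i * y i) k = mon x k * mon y k.
Proof. by rewrite -big_split; apply: eq_bigr => i _; rewrite expfzMl. Qed.

Lemma mon_pow (t : E) (e : 'I_n -> int) k : t != 0 ->
  mon (fun i => t ^ e i) k = t ^ (\sum_i e i * k i).
Proof.
move=> t0; rewrite /mon; elim/big_rec2: _ => [|i a b _ ->]; first by rewrite expr0z.
by rewrite expfzDr // exprz_exp.
Qed.

Lemma monN x k : mon x (fun i => - k i) = (mon x k)^-1.
Proof. by rewrite /mon -prodfV; apply: eq_bigr => i _; rewrite invr_expz. Qed.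

Lemma mon_unit (O : set E) x k : convex_subring O ->
  (forall i, k i != 0 -> convex_unit O (x i)) -> convex_unit O (mon x k).
Proof.
move=> convO xU; apply: big_ind => [|a b|i _]; [exact: convex_unit1|exact: convex_unitM|].
have [->|k0] := eqVneq (k i) 0; first by rewrite expr0z; exact: convex_unit1.
by apply: convex_unitXz => //; exact: xU.
Qed.

End Monomials.

Lemma mon_map (n : nat) (L E : realFieldType) (iota : {rmorphism L -> E})
  (x : 'I_n -> L) k : iota (mon x k) = mon (fun i => iota (x i)) k.
Proof. by rewrite /mon rmorph_prod; apply: eq_bigr => i _; rewrite fmorphXz. Qed.

(** * Multiplicative form of the conditions defining $S$ *)

Section MPoly.
Variables (R : comNzRingType) (n : nat).
Local Notation A := {mpoly R[n]}.

Lemma hull_min (E : realFieldType) (rho : {rmorphism R -> E}) (x : 'I_n -> E)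
    (O : set E) : convex_subring O -> (forall c, O (rho c)) ->
  (forall i, O (x i)) -> hull (mmap rho x) `<=` O.
Proof.
move=> convO Orho Ox y [z yz].
have Oz : O (mmap rho x z).
  elim/mpoly_closed: z {y yz} => [c|i|f g|f g].
  - by rewrite mmapC; exact: Orho.
  - by rewrite mmapX mmap1U; exact: Ox.
  - by rewrite rmorphD; exact: convexD.
  - by rewrite rmorphM; exact: convexM.
by apply: (convex_le convO) Oz; rewrite (le_trans yz) // ler_norm.
Qed.

Lemma hull_C (E : realFieldType) (rho : {rmorphism R -> E}) (x : 'I_n -> E) c :
  hull (mmap rho x) (rho c).
Proof.
have [c0|c0] := leP 0 (rho c); first by exists c%:MP; rewrite mmapC ger0_norm.
by exists (- c)%:MP; rewrite mmapC raddfN ltr0_norm.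
Qed.

Lemma hull_X (E : realFieldType) (rho : {rmorphism R -> E}) (x : 'I_n -> E) i :
  0 < x i -> hull (mmap rho x) (x i).
Proof. by move=> x0; exists 'X_i; rewrite mmapX mmap1U gtr0_norm. Qed.

Lemma mon_ratio (k : 'I_n -> int) : exists P Q : A,
  forall (E : realFieldType) (phi : {rmorphism A -> E}),
    (forall i, 0 < phi 'X_i) ->
    0 < phi Q /\ mon (fun i => phi 'X_i) k * phi Q = phi P.
Proof.
pose pos (z : int) : nat := if z is Posz m then m else 0%N.
exists (\prod_i 'X_i ^+ pos (k i)), (\prod_i 'X_i ^+ pos (- k i)).
move=> E phi X0; rewrite !rmorph_prod /=; split.
  by apply: prodr_gt0 => i _; rewrite rmorphXn exprn_gt0.
rewrite /mon -big_split /=; apply: eq_bigr => i _; rewrite !rmorphXn /=.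
case: (k i) => [[|m]|m] /=; rewrite ?expr0z ?expr0 ?mulr1 //.
by rewrite NegzE -exprnN /= mulVf // expf_neq0 // gt_eqF.
Qed.

(** Writing the monomial as $P/Q$ with $Q>0$, the bound by $z$ is the polynomial inequality $P\le
    zQ$, which signs decide. The same [z] serves for [psi]. *)
Lemma hull_mon_signs (E E' : realFieldType) (phi : {rmorphism A -> E})
    (psi : {rmorphism A -> E'}) (k : 'I_n -> int) :
  (forall f, (0 < phi f) = (0 < psi f)) -> (forall i, 0 < phi 'X_i) ->
  hull phi (mon (fun i => phi 'X_i) k) -> hull psi (mon (fun i => psi 'X_i) k).
Proof.
move=> same X0 [z]; have X0' i : 0 < psi 'X_i by rewrite -same.
have [P [Q PQ]] := mon_ratio k.
have [Q0 eP] := PQ _ _ X0; have [Q0' eP'] := PQ _ _ X0'.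
rewrite gtr0_norm ?mon_gt0 // => kz; exists z; rewrite gtr0_norm ?mon_gt0 //.
rewrite -(ler_pM2r Q0') eP' -rmorphM -subr_ge0 -rmorphB leNgt -oppr_gt0 -rmorphN.
rewrite -same rmorphN oppr_gt0 -leNgt rmorphB subr_ge0 -eP rmorphM.
by rewrite ler_pM2r.
Qed.

Variables (q u : nat) (m : 'I_q -> 'I_n -> int) (h : 'I_u -> 'I_n -> int).

(** The exponents [m j] and [h l] are the rational weights with denominators cleared: the second
    clause says that a monomial has positive value, the third that it has value 0. *)
Definition valuation_conditions (E : realFieldType) (phi : A -> E) : Prop :=
  [/\ forall i, 0 < phi 'X_i,
      forall j, ~ hull phi (mon (fun i => phi 'X_i) (m j))^-1 &
      forall l, convex_unit (hull phi) (mon (fun i => phi 'X_i) (h l))].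

Lemma valuation_conditions_signs (E E' : realFieldType) (phi : {rmorphism A -> E})
    (psi : {rmorphism A -> E'}) :
  (forall f, (0 < phi f) = (0 < psi f)) -> valuation_conditions phi -> valuation_conditions psi.
Proof.
move=> same [X0 mS hS]; have X0' i : 0 < psi 'X_i by rewrite -same.
have same' f : (0 < psi f) = (0 < phi f) by rewrite same.
split=> // [j|l].
  by rewrite -monN => mj; apply: (mS j); rewrite -monN; exact: hull_mon_signs mj.
have [hl hVl] := hS l; split; first exact: hull_mon_signs hl.
by rewrite -monN; apply: (hull_mon_signs same X0); rewrite monN.
Qed.

Variables (omega : 'I_n -> 'I_q -> rat) (theta : 'I_n -> 'I_u -> rat) (N : nat).
Hypotheses (N_gt0 : (0 < N)%N)
  (omegaE : forall i j, N%:R * omega i j = (m j i)%:~R)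
  (thetaE : forall i l, N%:R * theta i l = (h l i)%:~R).

(** Positivity of the coordinates makes their values finite, and forces [g i] to be the class of
    ['X_i]. Sums of values then become classes of monomials. *)
Lemma valuation_conditions_residue (d : sper A) :
  ((forall i : 'I_n, 0 < sper_eval d 'X_i) /\
    exists g : 'I_n -> val_group (sper_ring d),
      [/\ forall i : 'I_n, sper_nu d 'X_i = Some (g i),
          forall j : 'I_q, tensQ_gt0 (\sum_(i < n) tens (g i) (omega i j)) &
          forall l : 'I_u, \sum_(i < n) tens (g i) (theta i l) = 0]) <->
  valuation_conditions (residue d).
Proof.
have hullE : hull (residue d) = [set y | y \in @val_ring (sper_ring d)].
  apply/seteqP; split=> y /=.
    by move=> [z yz]; apply/asboolP; exists (sper_eval d z).
  move=> /asboolP[z yz]; exists (repr z); rewrite /residue /sper_eval.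
  by rewrite reprK.
rewrite /valuation_conditions hullE /=.
have posE : (forall i, 0 < residue d 'X_i) <-> (forall i, 0 < sper_eval d 'X_i).
  by split=> X0 i; move: (X0 i); rewrite residue_gt0.
split=> [[/posE X0 [g [gX gm gh]]]|[X0 mS hS]].
  have Xu i : { x : units_add (residue_field d) |
      val x = residue d 'X_i & g i = val_class x }.
    move: (gX i); rewrite /sper_nu /nu.
    case: insubP => //= x _ xE [gE]; exists x => //.
  pose x i := s2val (Xu i).
  have xE i : val (x i) = residue d 'X_i by rewrite /x; case: (Xu i).
  have gE i : g i = val_class (x i) by rewrite /x; case: (Xu i).
  have sumE (k : 'I_n -> int) :
      \sum_i g i *~ k i = val_class (\sum_i x i *~ k i).
    by rewrite raddf_sum; apply: eq_bigr => i _; rewrite gE raddfMz.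
  have monE (k : 'I_n -> int) :
      val (\sum_i x i *~ k i) = mon (fun i => residue d 'X_i) k.
    by rewrite val_units_sum; apply: eq_bigr => i _; rewrite xE.
  split=> // [j|l].
    move: (gm j) => /(tensQ_sum_gt0 _ N_gt0 (fun i => omegaE i j)).
    by rewrite sumE => /val_class_gt0; rewrite monE => /negP.
  move: (gh l) => /(tens_sum_eq0 (@val_group_torsion_free _) _ N_gt0 (fun i => thetaE i l)).
  rewrite sumE => /eqP; rewrite val_class_eq0 => /andP[].
  by rewrite monE.
split; first exact/posE.
pose x i : units_add (residue_field d) := UnitsAdd (lt0r_neq0 (X0 i)).
exists (fun i => val_class (x i)).
have sumE (k : 'I_n -> int) :
    \sum_i val_class (x i) *~ k i = val_class (\sum_i x i *~ k i).
  by rewrite raddf_sum; apply: eq_bigr => i _; rewrite raddfMz.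
have monE (k : 'I_n -> int) :
    val (\sum_i x i *~ k i) = mon (fun i => residue d 'X_i) k.
  by rewrite val_units_sum.
split=> [i|j|l].
- rewrite /sper_nu /nu; case: insubP => [y _ yE|]; last first.
    by move=> /negP; case; exact: lt0r_neq0 (X0 i).
  by congr Some; congr val_class; apply: val_inj; rewrite yE.
- apply/(tensQ_sum_gt0 _ N_gt0 (fun i => omegaE i j)).
  by rewrite sumE; apply/val_class_gt0; rewrite monE; apply/negP.
- apply/(tens_sum_eq0 (@val_group_torsion_free _) _ N_gt0 (fun i => thetaE i l)).
  rewrite sumE; apply/eqP; rewrite val_class_eq0; have [h1 h2] := hS l.
  by apply/andP; rewrite monE.
Qed.

End MPoly.

(** * Gordan's theorem *)

Section Gordan.
Variable F : realFieldType.

Lemma small_perturbation (T : eqType) (s : seq T) (f g : T -> F) :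
  (forall c, c \in s -> 0 < f c) ->
  exists2 eta, 0 < eta & forall c, c \in s -> 0 < f c + eta * g c.
Proof.
move=> f0; suff [e0 e00 e0P] : exists2 e0, 0 < e0 &
    forall e, 0 < e <= e0 -> forall c, c \in s -> 0 < f c + e * g c.
  by exists e0 => // c; apply: e0P; rewrite e00 lexx.
elim: s f0 => [|c s IH] f0; first by exists 1.
have [e0 e00 e0P] := IH (fun d ds => f0 d (@mem_behead _ (c :: s) d ds)).
have fc0 := f0 c (mem_head _ _).
have gc0 : 0 < `|g c| + 1 by rewrite ltr_wpDl.
(* This bound gives $e|g(c)| < f(c)$ with room to spare; the added 1 keeps the denominator
   nonzero. *)
exists (Num.min e0 (f c / 2%:R / (`|g c| + 1))).
  by rewrite lt_min e00 !divr_gt0 // ltr0n.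
move=> e; rewrite le_min => /andP[e_gt0 /andP[ee0 ec]] d.
rewrite in_cons => /orP[/eqP ->|]; last by apply: e0P; rewrite e_gt0.
rewrite ler_pdivlMr // in ec.
have : - (e * `|g c|) <= e * g c.
  by rewrite -mulrN ler_pM2l // lerNl -normrN ler_norm.
lra.
Qed.

Variables (n r : nat) (W : 'M[F]_(r, n)) (Pos : 'rV[F]_n -> Prop).
Hypotheses (PosD : forall c d, Pos c -> Pos d -> Pos (c + d))
  (PosZ : forall t c, 0 < t -> Pos c -> Pos (t *: c))
  (PosW : forall c, Pos c -> ~~ (c <= W)%MS).

Local Notation ev c a := ((c *m a : 'M[F]_1) 0 0).

(** [PosD], [PosZ] and [PosW] say that no positive combination of the forms falls into the row space
    of [W], which is the excluded alternative of Gordan's theorem. An abstract [Pos] lets the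
    induction replace the forms by combinations of them. *)
Lemma gordan (C : seq 'rV[F]_n) : (forall c, c \in C -> Pos c) ->
  exists2 a : 'cV[F]_n, W *m a = 0 & forall c, c \in C -> 0 < ev c a.
Proof.
elim: {C}(size C) {-2}C (erefl (size C)) => [|k IH] [|d C] //= sC CP.
  by exists 0; rewrite ?mulmx0.
case: sC => sC.
have dP : Pos d by apply: CP; exact: mem_head.
have {}CP c : c \in C -> Pos c by move=> cC; apply: CP; rewrite in_cons cC orbT.
have evD c (a a' : 'cV[F]_n) : ev c (a + a') = ev c a + ev c a'.
  by rewrite mulmxDr mxE.
have evZ c t (a : 'cV[F]_n) : ev c (t *: a) = t * ev c a.
  by rewrite -scalemxAr mxE.
have evDl (c c' : 'rV[F]_n) t (a : 'cV[F]_n) : ev (c + t *: c') a = ev c a + t * ev c' a.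
  by rewrite mulmxDl -scalemxAl !mxE.
have [a Wa aC] := IH C sC CP.
have [ad|ad|ad] := ltgtP (ev d a) 0.
(* Here [a] fails for [d]. Each [f c] is the positive combination of [c] and [d] that vanishes at
   [a], so the induction hypothesis applies to the forms [f c]. *)
- pose f c := c + (ev c a / - ev d a) *: d.
  have ad' : 0 < - ev d a by rewrite oppr_gt0.
  have fC : forall c, c \in map f C -> Pos c.
    move=> _ /mapP[c cC ->]; apply: PosD; first exact: CP.
    by apply: PosZ => //; rewrite divr_gt0 // aC.
  have [a' Wa' aC'] := IH (map f C) (etrans (size_map _ _) sC) fC.
  have [eta eta0 etaP] := @small_perturbation _ C (fun c => ev (f c) a')
    (fun c => - (ev c a / - ev d a)) (fun c cC => aC' _ (map_f f cC)).
  (* The multiple of [a] for which [d] takes exactly the value [eta] at [a' + lam *: a]; there [c]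
     takes the value of [f c] at [a'] up to a multiple of [eta]. *)
  pose lam := (ev d a' - eta) / - ev d a.
  have lamE : lam * - ev d a = ev d a' - eta.
    by rewrite /lam mulfVK // gt_eqF.
  exists (a' + lam *: a).
    by rewrite mulmxDr -scalemxAr Wa Wa' scaler0 addr0.
  move=> c; rewrite in_cons => /orP[/eqP ->|cC].
    by rewrite evD evZ; lra.
  have := etaP c cC; rewrite /f evDl evD evZ => h.
  set s := ev c a / - ev d a in h.
  have sE : s * - ev d a = ev c a by rewrite /s mulfVK // gt_eqF.
  have : ev c a' + lam * ev c a = ev c a' + s * ev d a' + eta * - s.
    rewrite -sE mulrCA lamE; lra.
  by move=> ->.
- by exists a => // c; rewrite in_cons => /orP[/eqP ->|/aC].
(* The form [d] vanishes at [a] but is outside the row space of [W], so it is nonzero on some column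
   of the cokernel matrix. *)
- have [b Wb bd] : exists2 b : 'cV[F]_n, W *m b = 0 & 0 < ev d b.
    have [j dj] : exists j, (d *m cokermx W) 0 j != 0.
      apply/existsP; apply: contraNT (PosW dP) => /existsPn dj.
      rewrite submxE; apply/eqP/rowP => j; rewrite [RHS]mxE.
      by apply/eqP; have := dj j; rewrite negbK.
    exists ((d *m cokermx W) 0 j *: col j (cokermx W)).
      by rewrite -scalemxAr colE (mulmxA W) mulmx_coker mul0mx scaler0.
    have dcol : ev d (col j (cokermx W)) = (d *m cokermx W) 0 j.
      by rewrite colE (mulmxA d) -colE mxE.
    by rewrite evZ dcol -expr2 exprn_even_gt0.
  have [eta eta0 etaP] := @small_perturbation _ C (fun c => ev c a)
    (fun c => ev c b) aC.
  exists (a + eta *: b).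
    by rewrite mulmxDr -scalemxAr Wa Wb scaler0 addr0.
  move=> c; rewrite evD evZ in_cons => /orP[/eqP ->|/etaP //].
  by rewrite ad add0r mulr_gt0.
Qed.

End Gordan.

Lemma monD (n : nat) (E : realFieldType) (x : 'I_n -> E) (k k' : 'I_n -> int) :
  (forall i, 0 < x i) -> mon x (fun i => k i + k' i) = mon x k * mon x k'.
Proof.
move=> x0; rewrite /mon -big_split /=; apply: eq_bigr => i _.
by rewrite expfzDr // gt_eqF.
Qed.

Lemma monZ (n : nat) (E : realFieldType) (x : 'I_n -> E) (k : 'I_n -> int) z :
  mon x (fun i => k i * z) = mon x k ^ z.
Proof.
rewrite /mon; elim/big_rec2: _ => [|i a b _ ->]; first by rewrite exp1rz.
by rewrite expfzMl exprz_exp.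
Qed.

Section Direction.
Variables (n q u : nat) (K : realFieldType) (O : set K) (x : 'I_n -> K).
Variables (m : 'I_q -> 'I_n -> int) (h : 'I_u -> 'I_n -> int).
Hypotheses (convO : convex_subring O) (x0 : forall i, 0 < x i)
  (xO : forall i, O (x i))
  (mO : forall j, ~ O (mon x (m j))^-1)
  (hO : forall l, convex_unit O (mon x (h l))).

(** Monomials need integer exponents, while [gordan] works with vectors over a field; [k] is [c]
    with denominators cleared by [N]. *)
Let rep (N : nat) (k : 'I_n -> int) (c : 'rV[rat]_n) : Prop :=
  (0 < N)%N /\ forall i, N%:R * c 0 i = (k i)%:~R.
Let unitP (c : 'rV[rat]_n) := exists N k, rep N k c /\ convex_unit O (mon x k).
Let posP (c : 'rV[rat]_n) := exists N k, rep N k c /\ ~ O (mon x k)^-1.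

Let nonunit_le1 y : 0 < y -> ~ O y^-1 -> y <= 1.
Proof.
move=> y0 yO; rewrite leNgt; apply/negP => y1; apply: yO.
by apply: convex_le1; rewrite ?invr_gt0 // invf_le1 // ltW.
Qed.

Let repD N k c N' k' c' : rep N k c -> rep N' k' c' ->
  rep (N * N')%N (fun i => k i * N' + k' i * N) (c + c').
Proof.
move=> [N0 cE] [N'0 cE']; split=> [|i]; first by rewrite muln_gt0 N0.
rewrite mxE mulrDr natrM mulrAC cE -mulrA cE' rmorphD /= !intrM.
by rewrite -!pmulrn [N%:R * _]mulrC.
Qed.

Let repZ N k c (t : rat) : 0 <= t -> rep N k c ->
  rep (N * `|denq t|)%N (fun i => k i * numq t) (t *: c).
Proof.
move=> t0 [N0 cE]; split=> [|i]; first by rewrite muln_gt0 N0 absz_gt0 denq_neq0.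
rewrite mxE natrM [t * _]mulrC mulrACA cE intrM numqE; congr (_ * _).
rewrite mulrC; congr (_ * _).
by rewrite -[LHS]/(`|denq t|%N%:Z%:~R) gez0_abs ?denq_ge0.
Qed.

Let posD c c' : posP c -> posP c' -> posP (c + c').
Proof.
move=> [N [k [cN kO]]] [N' [k' [cN' kO']]].
exists (N * N')%N, (fun i => k i * N' + k' i * N); split; first exact: repD.
rewrite monD // !monZ invfM => kkO; apply: kO; move: cN' => [N'0 _].
apply: (convex_root convO N'0); rewrite exprVn.
have k'1 := nonunit_le1 (mon_gt0 k' x0) kO'.
have := convexM convO kkO (convexX convO N (convex_le1 convO (mon_gt0 k' x0) k'1)).
by rewrite /= mulfVK // expf_neq0 // gt_eqF // mon_gt0.
Qed.

Let posZ (t : rat) c : 0 < t -> posP c -> posP (t *: c).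
Proof.
move=> t0 [N [k [cN kO]]].
exists (N * `|denq t|)%N, (fun i => k i * numq t); split.
  by apply: repZ => //; exact: ltW.
rewrite monZ => kO'; apply: kO; have nt0 : 0 < numq t by rewrite numq_gt0.
move: kO'; case: (numq t) nt0 => // p p0; rewrite -exprVn.
exact: convex_root.
Qed.

Let unitD c c' : unitP c -> unitP c' -> unitP (c + c').
Proof.
move=> [N [k [cN kU]]] [N' [k' [cN' kU']]].
exists (N * N')%N, (fun i => k i * N' + k' i * N); split; first exact: repD.
by rewrite monD // !monZ; apply: convex_unitM => //; apply: convex_unitXz.
Qed.

Let unitZ (t : rat) c : unitP c -> unitP (t *: c).
Proof.
have unitZ' (s : rat) : 0 <= s -> unitP c -> unitP (s *: c).
  move=> s0 [N [k [cN kU]]].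
  exists (N * `|denq s|)%N, (fun i => k i * numq s); split; first exact: repZ.
  by rewrite monZ; apply: convex_unitXz.
have [t0|/ltW t0] := leP 0 t; first exact: unitZ'.
move=> /(unitZ' (- t)); rewrite oppr_ge0 => /(_ t0) [N [k [[N0 cE] kU]]].
exists N, (fun i => - k i); rewrite monN; split; last exact: convex_unitV.
split=> // i; rewrite -[t]opprK scaleNr mxE mulrN cE.
by rewrite rmorphN.
Qed.

Let unit0 : unitP 0.
Proof.
exists 1%N, (fun=> 0); split; first by split=> // i; rewrite mxE mulr0.
rewrite /mon big1; first exact: convex_unit1.
by move=> i _; rewrite expr0z.
Qed.

Let pos_not_unit c : posP c -> ~ unitP c.
Proof.
move=> [N [k [[N0 cE] kO]]] [N' [k' [[N'0 cE'] kU]]]; apply: kO.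
have e i : k i * N' = k' i * N.
  apply/eqP; rewrite -(eqr_int rat) !intrM -cE -cE' -!pmulrn.
  by rewrite mulrAC [N%:R * _]mulrC mulrAC.
have : convex_unit O (mon x k ^ N').
  rewrite -monZ (_ : (fun i => k i * N') = (fun i => k' i * N)).
    by rewrite monZ; apply: convex_unitXz.
  by apply/funext.
move=> /(convex_unit_root convO) []//.
by case: (N') N'0.
Qed.

(** The integers [a i] imitate the values of the [x i]: they vanish where [x i] is a unit, in
    particular where [x i > 1], and are positive elsewhere. Gordan's theorem applies because values
    themselves make the prescribed forms positive and the prescribed relations zero. *)
Lemma direction : exists a : 'I_n -> int,
  [/\ forall i, 0 <= a i, forall i, 1 < x i -> a i = 0,
      forall j, 0 < \sum_i a i * m j i & forall l, \sum_i a i * h l i = 0].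
Proof.
pose ux i : bool := `[< convex_unit O (x i) >].
pose row_of (k : 'I_n -> int) : 'rV[rat]_n := \row_i (k i)%:~R.
have row_rep k : rep 1 (k) (row_of k) by split=> // i; rewrite mxE mul1r.
pose del i : 'I_n -> int := fun i' => (i == i')%:R.
have monDel i : mon x (del i) = x i.
  rewrite /mon (bigD1 i) //= /del eqxx expr1z big1 ?mulr1 // => i' i'i.
  by rewrite eq_sym (negbTE i'i) expr0z.
(* Besides the relations [h], the rows force [a i = 0] at the unit coordinates; the rows of the
   other coordinates are zero padding. *)
pose W : 'M[rat]_(u + n, n) := \matrix_(i < u + n)
  match split i with
  | inl l => row_of (h l)
  | inr i => if ux i then row_of (del i) else 0
  end.
have WU c : (c <= W)%MS -> unitP c.
  move=> /submxP[D ->]; rewrite mulmx_sum_row.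
  apply: big_ind => [||i _]; [exact: unit0|exact: unitD|apply: unitZ].
  rewrite rowK; case: split => [l|i'].
    by exists 1%N, (h l); split.
  case: ifP => [/asboolP xU|_]; last exact: unit0.
  by exists 1%N, (del i'); split; rewrite // monDel.
have PosW c : posP c -> ~~ (c <= W)%MS.
  by move=> /pos_not_unit cU; apply/negP => /WU.
pose C := [seq row_of (m j) | j <- enum 'I_q] ++
  [seq row_of (del i) | i <- enum 'I_n & ~~ ux i].
have CP c : c \in C -> posP c.
  rewrite mem_cat => /orP[/mapP[j _ ->]|/mapP[i]].
    by exists 1%N, (m j).
  rewrite mem_filter => /andP[/asboolPn nu _] ->.
  exists 1%N, (del i); split=> //; rewrite monDel => xVO; apply: nu.
  by split.
have [al Wal Cal] := gordan posD posZ PosW CP.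
have [N [a [N0 aE]]] := common_denominator (fun i => al i 0).
have sumE k : N%:R * (row_of k *m al) 0 0 = (\sum_i a i * k i)%:~R.
  rewrite mxE mulr_sumr rmorph_sum; apply: eq_bigr => i _.
  by rewrite mxE /= intrM -aE mulrCA mulrC -mulrA mulrC.
have Wal_row i : row i W *m al = 0 by rewrite -row_mul Wal row0.
have a_del i : \sum_i' a i' * del i i' = a i.
  rewrite (bigD1 i) //= /del eqxx mulr1 big1 ?addr0 // => i' i'i.
  by rewrite eq_sym (negbTE i'i) mulr0.
have N0' : 0 < N%:R :> rat by rewrite ltr0n.
have a_unit i : ux i -> a i = 0.
  move=> uxi; have := Wal_row (rshift u i).
  rewrite rowK (unsplitK (inr i) : split (rshift u i) = inr i) uxi => e; move: (sumE (del i)).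
  by rewrite e mxE mulr0 a_del => /esym/eqP; rewrite intr_eq0 => /eqP.
exists a; split.
- move=> i; have [/a_unit ->//|nu] := boolP (ux i).
  have : row_of (del i) \in C.
    rewrite mem_cat; apply/orP; right; apply/mapP; exists i => //.
    by rewrite mem_filter nu mem_enum.
  move=> /Cal; rewrite -(pmulr_rgt0 _ N0') sumE a_del ltr0z.
  exact: ltW.
- move=> i x1; apply: a_unit; apply/asboolP; split=> //.
  by apply: convex_le1; rewrite ?invr_gt0 // invf_le1 // ltW.
- move=> j; have : row_of (m j) \in C.
    rewrite mem_cat; apply/orP; left; apply/mapP; exists j => //.
    by rewrite mem_enum.
  by move=> /Cal; rewrite -(pmulr_rgt0 _ N0') sumE ltr0z.
- move=> l; have := Wal_row (lshift n l).
  rewrite rowK (unsplitK (inl l) : split (lshift n l) = inl l) => e; move: (sumE (h l)).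
  by rewrite e mxE mulr0 => /esym/eqP; rewrite intr_eq0 => /eqP.
Qed.

End Direction.

(** * Infinitesimals *)

(** The order of $K[X]$ in which $X$ exceeds every constant; the inverse of $X$ is then
    infinitesimal over $K$. *)
Lemma lead_coef_cone (K : realFieldType) :
  prime_cone [set p : {poly K} | 0 <= lead_coef p].
Proof.
split=> /=.
- split=> /=.
  + move=> f g f0 g0; have [->|fN0] := eqVneq f 0; first by rewrite add0r.
    have [->|gN0] := eqVneq g 0; first by rewrite addr0.
    have [fg|gf|fg] := ltngtP (size f) (size g).
    * by rewrite addrC lead_coefDl.
    * by rewrite lead_coefDl.
    have lfg : 0 < lead_coef f + lead_coef g.
      by rewrite addr_gt0 // lt_def lead_coef_eq0 ?fN0 ?gN0.
    have fgE : (f + g)`_(size f).-1 = lead_coef f + lead_coef g.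
      by rewrite coefD {2}fg.
    suff sfg : size (f + g) = size f by rewrite lead_coefE sfg fgE ltW.
    apply/eqP; rewrite eqn_leq; apply/andP; split.
      by rewrite (leq_trans (size_polyD _ _)) // -fg maxnn.
    rewrite leqNgt; apply/negP => sfg.
    have : (f + g)`_(size f).-1 = 0.
      apply: nth_default; move: sfg.
      by move: (size (f + g)) (size f) => a b; lia.
    by rewrite fgE => /eqP; rewrite gt_eqF.
  + by move=> f g f0 g0; rewrite lead_coefM mulr_ge0.
  + by move=> f; rewrite lead_coefM -expr2 sqr_ge0.
  + by rewrite lead_coefN lead_coef1 oppr_ge0 ler10.
- by move=> f; rewrite lead_coefN oppr_ge0; apply/orP; exact: le_total.
move=> f g fg0; rewrite lead_coefN oppr_ge0 => fg0'.
have /eqP : lead_coef (f * g) = 0 by apply/eqP; rewrite eq_le fg0 fg0'.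
rewrite lead_coef_eq0 mulf_eq0 => /orP[] /eqP ->; [left|right];
  by rewrite oppr0 lead_coef0.
Qed.

Lemma order_ext_gt0 (K E : realFieldType) (iota : {rmorphism K -> E}) x :
  order_ext iota -> (0 < iota x) = (0 < x).
Proof. by move=> iotaE; rewrite -(rmorph0 iota) (leW_mono iotaE). Qed.

Lemma order_ext_norm (K E : realFieldType) (iota : {rmorphism K -> E}) x :
  order_ext iota -> `|iota x| = iota `|x|.
Proof.
move=> iotaE; have [x0|x0] := leP 0 x.
  by rewrite [`|x|]ger0_norm // ger0_norm // -(rmorph0 iota) iotaE.
rewrite [`|x|]ltr0_norm // rmorphN ltr0_norm //.
by rewrite -(rmorph0 iota) (leW_mono iotaE).
Qed.

Definition infinitesimal (K E : realFieldType) (iota : {rmorphism K -> E})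
    (eps : E) : Prop :=
  0 < eps /\ forall c : K, 0 < c -> eps < iota c.

Lemma infinite_ext (K : realFieldType) :
  exists (E : realFieldType) (iota : {rmorphism K -> E}) (X : E),
    order_ext iota /\ forall c : K, iota c < X.
Proof.
pose alpha := sper_of_cone (lead_coef_cone K).
have alphaK (c : K) : 0 <= c -> 0 <= sper_eval alpha c%:P.
  by move=> c0; apply/sper_of_cone_ge0; rewrite /= lead_coefC.
have Xc (c : K) : const_residue alpha c < residue alpha 'X.
  rewrite -subr_gt0.
  have -> : residue alpha 'X - const_residue alpha c = residue alpha ('X - c%:P).
    by rewrite rmorphB.
  rewrite residue_gt0; apply/sper_of_cone_gt0.
  by rewrite /= lead_coefN lead_coefXsubC oppr_ge0 ler10.
by exists (residue_field alpha), (const_residue alpha), (residue alpha 'X);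
  split; [exact: const_residue_ext|].
Qed.

Lemma infinitesimal_ext (K : realFieldType) :
  exists (E : realFieldType) (iota : {rmorphism K -> E}) (eps : E),
    order_ext iota /\ infinitesimal iota eps.
Proof.
have [E [iota [X [iotaE Xc]]]] := infinite_ext K.
have X0 : 0 < X by rewrite -(rmorph0 iota).
exists E, iota, X^-1; split=> //; split=> [|c c0]; first by rewrite invr_gt0.
rewrite -[c]invrK fmorphV ltf_pV2 ?posrE //.
by rewrite order_ext_gt0 // invr_gt0.
Qed.

Lemma infinitesimal_comp (K L E : realFieldType) (iota : {rmorphism K -> L})
    (kappa : {rmorphism L -> E}) eps :
  order_ext kappa -> infinitesimal iota eps ->
  infinitesimal (kappa \o iota) (kappa eps).
Proof.
move=> kappaE [e0 eK]; split=> [|c c0].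
  by rewrite -(rmorph0 kappa) (leW_mono kappaE).
by rewrite (leW_mono kappaE) eK.
Qed.

Lemma infinitesimal_sub (K L E : realFieldType) (iota : {rmorphism K -> L})
    (kappa : {rmorphism L -> E}) eps :
  order_ext iota -> infinitesimal kappa eps ->
  infinitesimal (kappa \o iota) eps.
Proof.
move=> iotaE [e0 eL]; split=> // c c0; apply: eL.
by rewrite -(rmorph0 iota) (leW_mono iotaE).
Qed.

Lemma infinitesimal_lt1 (K E : realFieldType) (iota : {rmorphism K -> E}) eps :
  infinitesimal iota eps -> eps < 1.
Proof. by move=> [_ eK]; rewrite -(rmorph1 iota); apply: eK; rewrite ltr01. Qed.

Section InfinitesimalSign.
Variable R : realFieldType.

Lemma eval_at_bounded (p : {poly R}) : exists2 b : R, 0 < b &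
  forall (E : realFieldType) (rho : {rmorphism R -> E}) eps,
    order_ext rho -> infinitesimal rho eps -> `|eval_at rho eps p| <= rho b.
Proof.
elim/poly_ind: p => [|p c [b b0 bP]].
  exists 1 => // E rho eps _ _; rewrite rmorph0 normr0 rmorph1.
  exact: ler01.
exists (b + `|c|); first by rewrite ltr_wpDr.
move=> E rho eps rhoE eI; have [e0 _] := eI.
rewrite rmorphD rmorphM /= [eval_at _ _ 'X]/eval_at map_polyX hornerX.
rewrite [eval_at _ _ c%:P]/eval_at map_polyC hornerC rmorphD /=.
rewrite (le_trans (ler_normD _ _)) // lerD //.
  rewrite normrM (gtr0_norm e0) -[rho b]mulr1 ler_pM ?normr_ge0 //.
  - exact: ltW.
  - exact: bP.
  - exact: ltW (infinitesimal_lt1 eI).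
by rewrite order_ext_norm.
Qed.

(** The lowest nonzero coefficient decides the sign: in $p\varepsilon+c$ with $c\ne0$, the value of
    $p$ is bounded by an element of $R$, so $c$ dominates. *)
Lemma eval_at_infinitesimal (p : {poly R}) (E E' : realFieldType)
    (rho : {rmorphism R -> E}) (rho' : {rmorphism R -> E'}) eps eps' :
  order_ext rho -> order_ext rho' -> infinitesimal rho eps ->
  infinitesimal rho' eps' ->
  (0 < eval_at rho eps p) = (0 < eval_at rho' eps' p).
Proof.
move=> rhoE rhoE' eI eI'; elim/poly_ind: p => [|p c IH].
  by rewrite !rmorph0 !ltxx.
have evE (F : realFieldType) (r : {rmorphism R -> F}) e :
    eval_at r e (p * 'X + c%:P) = eval_at r e p * e + r c.
  rewrite rmorphD rmorphM /= [eval_at _ _ 'X]/eval_at map_polyX hornerX.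
  by rewrite [eval_at _ _ c%:P]/eval_at map_polyC hornerC.
rewrite !evE; have [->|c0] := eqVneq c 0.
  by rewrite !rmorph0 !addr0 !pmulr_lgt0 //; [case: eI'|case: eI].
have [b b0 bP] := eval_at_bounded p.
suff sgn (F : realFieldType) (r : {rmorphism R -> F}) e : order_ext r ->
    infinitesimal r e -> (0 < eval_at r e p * e + r c) = (0 < c).
  by rewrite !sgn.
move=> rE /[dup] eI0 [e0 eK].
have small : `|eval_at r e p * e| < r `|c|.
  rewrite normrM (gtr0_norm e0).
  have rb0 : 0 < r b by rewrite -(rmorph0 r) (leW_mono rE).
  apply: (le_lt_trans (ler_wpM2r (ltW e0) (bP _ _ _ rE eI0))).
  have -> : `|c| = b * (`|c| / b) by rewrite mulrCA mulfV ?mulr1 // gt_eqF.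
  rewrite rmorphM ltr_pM2l //; apply: eK.
  by rewrite divr_gt0 // normr_gt0.
have [cP|cN|cE] := ltgtP c 0; last by rewrite cE eqxx in c0.
  move: small; rewrite [`|c|]ltr0_norm // rmorphN ltr_norml => /andP[_ h].
  apply/negbTE; rewrite -leNgt; lra.
by move: small; rewrite [`|c|]gtr0_norm // ltr_norml => /andP[h _]; lra.
Qed.

End InfinitesimalSign.

(** Nonnegative elements of a real closed field are squares, and squares stay nonnegative in any
    ordered field. *)
Lemma rcf_order_ext (R : rcfType) (E : realFieldType) (rho : {rmorphism R -> E}) :
  order_ext rho.
Proof.
by apply: order_extP => x x0; rewrite -(sqr_sqrtr x0) rmorphXn sqr_ge0.
Qed.

Lemma infinitesimal_pt (R : rcfType) (n : nat) (a : 'I_n -> int)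
    (E E' : realFieldType) (rho : {rmorphism R -> E})
    (rho' : {rmorphism R -> E'}) eps eps' :
  infinitesimal rho eps -> infinitesimal rho' eps' ->
  same_signs (pt rho (fun i => eps ^ a i)) (pt rho' (fun i => eps' ^ a i)).
Proof.
move=> eI eI' f; rewrite [LHS]pt_gt0 [RHS]pt_gt0.
have [F [N FN]] := curve_poly (idfun : {rmorphism R -> R}) (fun=> 1) a f.
have sgn (G : realFieldType) (r : {rmorphism R -> G}) (e : G) : 0 < e ->
    (0 < mmap r (fun i => e ^ a i) f) = (0 < eval_at r e F).
  move=> e0; rewrite -FN // pmulr_lgt0 ?exprn_gt0 //.
  have -> // : curve (fun=> 1) a r e = fun i => e ^ a i.
  by apply/funext => i; rewrite /curve rmorph1 mul1r.
rewrite !sgn; [|by case: eI'|by case: eI].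
by apply: eval_at_infinitesimal; do ?exact: rcf_order_ext.
Qed.

(** * Contraction along monomial curves *)

Lemma mon_sum (n : nat) (J : finType) (E : realFieldType) (x : 'I_n -> E)
    (V : J -> 'I_n -> int) (c : J -> int) : (forall i, 0 < x i) ->
  mon x (fun i => \sum_j V j i * c j) = \prod_j mon x (V j) ^ c j.
Proof.
move=> x0; rewrite /mon.
under [RHS]eq_bigr do rewrite -monZ /mon.
rewrite exchange_big; apply: eq_bigr => i _ /=.
elim/big_rec2: _ => [|j a b _ <-]; first by rewrite expr0z.
by rewrite expfzDr // gt_eqF.
Qed.

Section Moves.
Variables (R : rcfType) (n q u : nat).
Variables (m : 'I_q -> 'I_n -> int) (h : 'I_u -> 'I_n -> int).
Variable S : set (sper {mpoly R[n]}).
Hypothesis S_pt : forall (E : realFieldType) (rho : {rmorphism R -> E}) x,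
  S (pt rho x) <-> [/\ forall i, 0 < x i,
    forall j, ~ hull (mmap rho x) (mon x (m j))^-1 &
    forall l, convex_unit (hull (mmap rho x)) (mon x (h l))].

(** Composites bracketed differently carry different morphism structures, so points are transported
    along pointwise equality. *)
Lemma S_pt_eq (E : realFieldType) (rho rho' : {rmorphism R -> E})
    (x x' : 'I_n -> E) :
  rho =1 rho' -> x =1 x' -> S (pt rho x) -> S (pt rho' x').
Proof.
move=> /funext rr /funext xx /S_pt Sx; apply/S_pt.
by move: Sx; rewrite -xx (_ : mmap rho x = mmap rho' x) // rr.
Qed.

Section Contraction.
Variables (K : realFieldType) (rho : {rmorphism R -> K}) (x : 'I_n -> K).
Hypothesis Sx : S (pt rho x).
Variable a : 'I_n -> int.
Hypotheses (a_ge0 : forall i, 0 <= a i) (a_big : forall i, 1 < x i -> a i = 0)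
  (a_m : forall j, 0 < \sum_i a i * m j i)
  (a_h : forall l, \sum_i a i * h l i = 0).

Let x0 i : 0 < x i. Proof. by move/S_pt: Sx => [+ _ _]. Qed.
Let mx j : ~ hull (mmap rho x) (mon x (m j))^-1.
Proof. by move/S_pt: Sx => [_ + _]. Qed.
Let hx l : convex_unit (hull (mmap rho x)) (mon x (h l)).
Proof. by move/S_pt: Sx => [_ _ +]. Qed.

Let O (E : realFieldType) (j : {rmorphism K -> E}) : set E :=
  hull (j \o mmap rho x).

Let convO (E : realFieldType) (j : {rmorphism K -> E}) : convex_subring (O j).
Proof. exact: (hull_convex (j \o mmap rho x : {rmorphism _ -> _})). Qed.

Let O_map (E : realFieldType) (j : {rmorphism K -> E}) y : order_ext j ->
  O j (j y) <-> hull (mmap rho x) y.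
Proof.
by move=> jE; split=> -[z yz]; exists z; move: yz; rewrite order_ext_norm //= jE.
Qed.

Let O_rho (E : realFieldType) (j : {rmorphism K -> E}) c : order_ext j ->
  O j (j (rho c)).
Proof. by move=> jE; apply/O_map => //; exact: hull_C. Qed.

Let O_x (E : realFieldType) (j : {rmorphism K -> E}) i : order_ext j ->
  O j (j (x i)).
Proof. by move=> jE; apply/O_map => //; exact: hull_X. Qed.

Let O_min (E : realFieldType) (j : {rmorphism K -> E}) (P : set E) :
  convex_subring P -> (forall c, P (j (rho c))) -> (forall i, P (j (x i))) ->
  O j `<=` P.
Proof.
move=> convP Prho Px y [z yz].
apply: (@hull_min _ _ _ (j \o rho) (fun i => j (x i)) P) => //.
by exists z; rewrite (@mmap_ext _ _ _ _ rho j x).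
Qed.

(** The hull does not change: coordinates only decrease, and those above 1 stay put because [a]
    vanishes there. The monomials [m] decrease and the monomials [h] are constant, so all conditions
    persist. *)
Lemma shrink_S (E : realFieldType) (j : {rmorphism K -> E}) tau :
  order_ext j -> 0 < tau -> tau <= 1 ->
  S (pt (j \o rho) (fun i => j (x i) * tau ^ a i)).
Proof.
move=> jE t0 t1.
have jx0 i : 0 < j (x i) by rewrite order_ext_gt0.
have ta0 i : 0 < tau ^ a i by rewrite exprz_gt0.
have ta1 i : tau ^ a i <= 1.
  by case: (a i) (a_ge0 i) => // k _; rewrite -exprnP exprn_ile1 // ltW.
have y0 i : 0 < j (x i) * tau ^ a i by rewrite mulr_gt0.
set H := hull (mmap (j \o rho) (fun i => j (x i) * tau ^ a i)).
have convH : convex_subring H := hull_convex _.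
have HO : H `<=` O j.
  apply: hull_min => [|c|i]; [exact: convO|exact: O_rho|].
  by apply: (convex_le_pos (convO j) (y0 i) _ (O_x i jE)); rewrite ger_pMr.
have OH : O j `<=` H.
  apply: O_min => [//|c|i]; first exact: hull_C.
  have [x1|x1] := leP (x i) 1.
    by apply: convex_le1 => //; rewrite -(rmorph1 j) jE.
  have : H (j (x i) * tau ^ a i) by exact: hull_X.
  by rewrite a_big // expr0z mulr1.
have monE k : mon (fun i => j (x i) * tau ^ a i) k =
    j (mon x k) * tau ^ (\sum_i a i * k i).
  by rewrite monM mon_pow ?gt_eqF // mon_map.
apply/S_pt; split=> [//|l Hl|l].
  apply: (mx (j := l)); apply/(O_map _ jE); rewrite fmorphV.
  apply: (convex_le_pos (convO j) _ _ (HO _ Hl)).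
    by rewrite invr_gt0 order_ext_gt0 // mon_gt0.
  have m0 : 0 < j (mon x (m l)) by rewrite order_ext_gt0 // mon_gt0.
  rewrite monE lef_pV2 ?posrE // ?mulr_gt0 ?exprz_gt0 //.
  rewrite ger_pMr //; case: (\sum_i _) (a_m l) => // k _.
  by rewrite -exprnP exprn_ile1 // ltW.
rewrite monE a_h expr0z mulr1; have [h1 h2] := hx l.
by split; apply: OH; rewrite -?fmorphV; apply/O_map.
Qed.

Section Infinitesimal.
Variables (L : realFieldType) (iota : {rmorphism K -> L}) (eps : L).
Hypotheses (iotaE : order_ext iota) (epsI : infinitesimal iota eps).

Let eps0 : 0 < eps. Proof. by case: epsI. Qed.

Lemma shrink_linked :
  linked S (pt rho x) (pt (iota \o rho) (fun i => iota (x i) * eps ^ a i)).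
Proof.
have curveS : interval_property eps 1 (fun E kappa tau => S
    (pt (kappa \o (iota \o rho)) (curve (iota \o x) a kappa tau))).
  move=> E kappa tau kappaE /andP[t0 t1].
  apply: (@S_pt_eq _ ((kappa \o iota) \o rho) _
    (fun i => (kappa \o iota) (x i) * tau ^ a i)) => //.
  apply: shrink_S.
  - by move=> y z /=; rewrite kappaE iotaE.
  - by apply: lt_le_trans t0; rewrite order_ext_gt0.
  - by rewrite (le_trans t1) // rmorph1.
have e1 : eps <= 1 by rewrite ltW // (infinitesimal_lt1 epsI).
have := @curve_linked _ _ _ _ _ _ _ _ _ eps0 curveS 1 eps.
rewrite !lexx e1 => /(_ isT isT) lnk.
apply: linked_trans lnk.
apply: same_signs_linked; apply: pt_ext => // i.
by rewrite /curve /= exp1rz mulr1.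
Qed.

(* Coordinates bounded above and below by elements of K do not interfere
   with the powers of an infinitesimal. *)
Let Kb (E : realFieldType) (j : {rmorphism K -> E}) : set E := hull j.
Let convK (E : realFieldType) (j : {rmorphism K -> E}) : convex_subring (Kb j).
Proof. exact: hull_convex. Qed.
Let Kb_map (E : realFieldType) (j : {rmorphism K -> E}) y : order_ext j ->
  Kb j (j y).
Proof. by move=> jE; exists `|y|; rewrite order_ext_norm. Qed.
Let Kb_unit (E : realFieldType) (j : {rmorphism K -> E}) y : order_ext j ->
  convex_unit (Kb j) (j y).
Proof. by move=> jE; split; rewrite -?fmorphV; exact: Kb_map. Qed.

(** The conditions on [m] come for free. All coordinates are bounded over [K], so the hull lies in
    the ring of elements bounded over [K], whereas the inverse monomial is a unit of that ring times
    a negative power of [e]. *)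
Lemma bounded_S (E : realFieldType) (j : {rmorphism K -> E}) (e : E)
    (y : 'I_n -> E) :
  order_ext j -> infinitesimal j e -> (forall i, 0 < y i) ->
  (forall i, convex_unit (Kb j) (y i)) ->
  (forall l, convex_unit (hull (mmap (j \o rho) (fun i => y i * e ^ a i)))
     (mon y (h l))) ->
  S (pt (j \o rho) (fun i => y i * e ^ a i)).
Proof.
move=> jE eI y0 yK yh; have [e0 eK] := eI.
have ye0 i : 0 < y i * e ^ a i by rewrite mulr_gt0 // exprz_gt0.
have ea1 i : e ^ a i <= 1.
  case: (a i) (a_ge0 i) => // k _; rewrite -exprnP exprn_ile1 ?ltW //.
  exact: infinitesimal_lt1 eI.
have monE k : mon (fun i => y i * e ^ a i) k = mon y k * e ^ (\sum_i a i * k i).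
  by rewrite monM mon_pow // gt_eqF.
apply/S_pt; split=> [//|l Hl|l]; last by rewrite monE a_h expr0z mulr1.
have : Kb j (mon (fun i => y i * e ^ a i) (m l))^-1.
  apply: hull_min Hl => [|c|i]; [exact: convK|exact: Kb_map|].
  apply: (convex_le_pos (convK j) (ye0 i) _ (yK i).1).
  by rewrite ger_pMr.
rewrite monE invfM => Kl.
have [my _] : convex_unit (Kb j) (mon y (m l)).
  by apply: mon_unit => [|i _]; [exact: convK|exact: yK].
have := convexM (convK j) my Kl.
rewrite mulVKf ?gt_eqF ?mon_gt0 //; case: (\sum_i _) (a_m l) => // k k0.
rewrite -exprnP -exprVn => /(convex_root (convK j) k0) [c ec].
have c0 : 0 < c.
  rewrite -(order_ext_gt0 c jE); apply: lt_le_trans ec.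
  by rewrite normr_gt0 invr_eq0 gt_eqF.
have : e < j c^-1 by apply: eK; rewrite invr_gt0.
rewrite gtr0_norm ?invr_gt0 // in ec.
rewrite fmorphV -[X in X < _]invrK ltf_pV2 ?posrE ?invr_gt0 ?order_ext_gt0 //.
by move=> /lt_le_trans/(_ ec); rewrite ltxx.
Qed.

(** As [beta] lies in [K], a parameter between 1 and [beta] stays bounded over [K] and does not
    disturb the infinitesimal. The disjunction covers both positions of [beta] with respect to 1. *)
Lemma move_linked (y : 'I_n -> K) (v : 'I_n -> int) (beta : K) : 0 < beta ->
  (forall (E : realFieldType) (j : {rmorphism K -> E}) (e tau : E),
     order_ext j -> infinitesimal j e -> 0 < tau ->
     (j beta <= tau <= 1) || (1 <= tau <= j beta) ->
     S (pt (j \o rho) (fun i => j (y i) * tau ^ v i * e ^ a i))) ->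
  linked S (pt (iota \o rho) (fun i => iota (y i) * eps ^ a i))
    (pt (iota \o rho) (fun i => iota (y i * beta ^ v i) * eps ^ a i)).
Proof.
move=> b0 yS.
pose c i := iota (y i) * eps ^ a i.
pose lo := Num.min (iota beta) 1; pose hi := Num.max (iota beta) 1.
have ib0 : 0 < iota beta by rewrite order_ext_gt0.
have lo0 : 0 < lo by rewrite /lo lt_min ib0 ltr01.
have curveS : interval_property lo hi (fun E kappa tau => S
    (pt (kappa \o (iota \o rho)) (curve c v kappa tau))).
  move=> E kappa tau kappaE tauE.
  have jE : order_ext (kappa \o iota) by move=> ? ? /=; rewrite kappaE iotaE.
  have -> : curve c v kappa tau =
      fun i => (kappa \o iota) (y i) * tau ^ v i * kappa eps ^ a i.
    by apply/funext => i; rewrite /curve /c rmorphM fmorphXz /= mulrAC.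
  apply: (@S_pt_eq _ ((kappa \o iota) \o rho)) (yS _ (kappa \o iota) _ _ _ _ _ _) => //.
  - exact: infinitesimal_comp.
  - by case/andP: tauE => + _; apply: lt_le_trans; rewrite order_ext_gt0.
  - move: tauE; rewrite /lo /hi; have [b1|b1] := leP (iota beta) 1.
      by rewrite /= rmorph1 => ->.
    by rewrite /= rmorph1 => ->; rewrite orbT.
have lnk := @curve_linked _ _ _ _ _ _ _ _ _ lo0 curveS 1 (iota beta).
have {}lnk : linked S (pt (iota \o rho) (curve c v idfun 1))
    (pt (iota \o rho) (curve c v idfun (iota beta))).
  by apply: lnk; rewrite /lo /hi ge_min le_max ?lexx ?orbT.
have -> : (fun i => iota (y i) * eps ^ a i) = curve c v idfun 1.
  by apply/funext => i; rewrite /curve /= exp1rz mulr1.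
have -> // : (fun i => iota (y i * beta ^ v i) * eps ^ a i) =
    curve c v idfun (iota beta).
by apply/funext => i; rewrite /curve /c /= rmorphM fmorphXz mulrAC.
Qed.
Let O_unit_map (E : realFieldType) (j : {rmorphism K -> E}) y : order_ext j ->
  convex_unit (hull (mmap rho x)) y -> convex_unit (O j) (j y).
Proof. by move=> jE [y1 y2]; split; rewrite -?fmorphV; apply/O_map. Qed.

Let H0 := hull (mmap rho x).
Let convH0 : convex_subring H0. Proof. exact: hull_convex. Qed.

(** The unmoved coordinates above 1 keep the original hull inside the new one, so units of the
    former remain units. *)
Lemma fixed_large_S (E : realFieldType) (j : {rmorphism K -> E}) (e : E)
    (y : 'I_n -> E) :
  order_ext j -> infinitesimal j e -> (forall i, 0 < y i) ->
  (forall i, convex_unit (Kb j) (y i)) ->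
  (forall i, 1 < x i -> y i = j (x i)) ->
  (forall l, convex_unit (O j) (mon y (h l))) ->
  S (pt (j \o rho) (fun i => y i * e ^ a i)).
Proof.
move=> jE eI y0 yK yx yh; apply: bounded_S => // l; have [e0 _] := eI.
set H := hull _.
have convH : convex_subring H := hull_convex _.
have OH : O j `<=` H.
  apply: O_min => [//|c|i]; first exact: hull_C.
  have [x1|x1] := leP (x i) 1.
    by apply: convex_le1; rewrite ?order_ext_gt0 // -(rmorph1 j) jE.
  have : H (y i * e ^ a i) by apply: hull_X; rewrite mulr_gt0 // exprz_gt0.
  by rewrite a_big // expr0z mulr1 yx.
by have [h1 h2] := yh l; split; apply: OH.
Qed.

Let fixed_large (y : 'I_n -> K) : Prop :=
  [/\ forall i, 0 < y i, forall i, 1 < x i -> y i = x i &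
      forall l, convex_unit H0 (mon y (h l))].

(** If the direction [v] changes some [h]-monomial, [beta] must be a unit; by convexity every
    parameter between 1 and [beta] is then a unit too, and the monomial remains one. *)
Lemma fixed_large_move (y : 'I_n -> K) (v : 'I_n -> int) (beta : K) :
  fixed_large y -> 0 < beta -> (forall i, 1 < x i -> v i = 0) ->
  (forall l, \sum_i v i * h l i != 0 -> convex_unit H0 beta) ->
  fixed_large (fun i => y i * beta ^ v i) /\
  linked S (pt (iota \o rho) (fun i => iota (y i) * eps ^ a i))
    (pt (iota \o rho) (fun i => iota (y i * beta ^ v i) * eps ^ a i)).
Proof.
move=> [y0 yx yh] b0 vx bU; split.
  split=> [i|i xi|l]; first by rewrite mulr_gt0 // exprz_gt0.
    by rewrite yx // vx // expr0z mulr1.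
  rewrite monM mon_pow ?gt_eqF //; apply: convex_unitM => //.
  have [->|/bU ?] := eqVneq (\sum_i v i * h l i) 0.
    by rewrite expr0z; exact: convex_unit1.
  exact: convex_unitXz.
apply: move_linked => // E j e tau jE eI t0 tb.
have jb0 : 0 < j beta by rewrite order_ext_gt0.
apply: fixed_large_S => // [i|i|i xi|l].
- by rewrite mulr_gt0 ?order_ext_gt0 // exprz_gt0.
- apply: convex_unitM; [exact: convK|exact: Kb_unit|].
  apply: convex_unitXz; first exact: convK.
  by apply: (convex_unit_between (convK j) t0 (Kb_unit beta jE)).
- by rewrite vx // expr0z mulr1 yx.
- rewrite monM mon_pow ?gt_eqF //; apply: convex_unitM; first exact: convO.
    by rewrite -mon_map; apply: O_unit_map.
  have [->|/bU bU'] := eqVneq (\sum_i v i * h l i) 0.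
    by rewrite expr0z; apply: convex_unit1; exact: convO.
  apply: convex_unitXz; first exact: convO.
  by apply: (convex_unit_between (convO j) t0 (O_unit_map jE bU')).
Qed.

Let xl i : K := if 1 < x i then x i else 1.
Let xs i : K := if 1 < x i then 1 else x i.

(** With $M=PDV$ in Smith form, the rows of $V$ give new multiplicative coordinates $b_j$ of the
    small part of [x], to be removed one at a time. Removing $b_j$ affects the [h]-monomials only if
    column $j$ of $D$ is nonzero, and then a nonzero power of $b_j$ is a product of units. *)
Lemma small_to_1_linked :
  linked S (pt (iota \o rho) (fun i => iota (x i) * eps ^ a i))
    (pt (iota \o rho) (fun i => iota (xl i) * eps ^ a i)).
Proof.
have xs0 i : 0 < xs i by rewrite /xs; case: ifP.
pose M : 'M[int]_(u, n) := \matrix_(l, i) if 1 < x i then 0 else h l i.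
have [P Pu [V Vu [d _ ME]]] := int_Smith_normal_form M.
pose D : 'M[int]_(u, n) := \matrix_(i, j) (d`_i *+ (i == j :> nat)).
rewrite -/D in ME.
pose b (j : 'I_n) : K := mon xs (fun i => V j i).
(* A small $x_i$ is $\prod_j b_j^{(V^{-1})_{ij}}$; using each [v j] once therefore brings it to
   1. *)
pose v (j i : 'I_n) : int := if 1 < x i then 0 else - invmx V i j.
have b0 j : 0 < b j by exact: mon_gt0.
have vh (j : 'I_n) l : \sum_i v j i * h l i = - (P *m D) l j.
  have -> : P *m D = M *m invmx V by rewrite ME mulmxK.
  rewrite mxE -sumrN; apply: eq_bigr => i _; rewrite /v mxE.
  by case: ifP => _; rewrite ?mul0r ?oppr0 // mulNr mulrC.
have monM_unit l : convex_unit H0 (mon xs (M l)).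
  have -> : mon xs (M l) = mon x (h l) * (mon xl (h l))^-1.
    rewrite /mon -prodfV -big_split /=; apply: eq_bigr => i _.
    rewrite /xs /xl mxE; case: ifP => _.
      by rewrite expr0z mulfV // expfz_neq0 // gt_eqF.
    by rewrite exp1rz invr1 mulr1.
  apply: convex_unitM => //; apply: convex_unitV.
  apply: mon_unit => // i _; rewrite /xl; case: ifP => xi; last exact: convex_unit1.
  split; first exact: hull_X.
  by apply: convex_le1; rewrite ?invr_gt0 // invf_le1 // ltW.
have bU j l : \sum_i v j i * h l i != 0 -> convex_unit H0 (b j).
  rewrite vh oppr_eq0 => PD0.
  have [l' Dl'] : exists l', D l' j != 0.
    apply/existsP; apply: contraNT PD0 => /existsPn D0.
    rewrite mxE big1 // => l' _; have := D0 l'; rewrite negbK => /eqP ->.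
    by rewrite mulr0.
  apply: (convex_unit_root convH0 Dl').
  (* Row [l'] of $DV=P^{-1}M$, whose only contribution on the left comes from the diagonal entry at
     [j]. *)
  have -> : b j ^ D l' j = \prod_l0 mon xs (M l0) ^ invmx P l' l0.
    rewrite -mon_sum // -monZ; apply: eq_bigr => i _; congr (_ ^ _).
    have : (D *m V) l' i = (invmx P *m M) l' i by rewrite ME -mulmxA mulKmx.
    rewrite mxE [RHS]mxE (bigD1 j) //= big1 => [|j' j'j]; last first.
      rewrite mxE; suff -> : (l' == j' :> nat) = false by rewrite mul0r.
      apply/negbTE; apply: contra Dl' => /eqP l'j'; rewrite mxE l'j'.
      suff -> : (j' == j :> nat) = false by [].
      exact/negbTE.
    rewrite addr0 mulrC => ->; apply: eq_bigr => l0 _; exact: mulrC.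
  apply: big_ind => [||l0 _]; [exact: convex_unit1|exact: convex_unitM|].
  exact: convex_unitXz.
pose yof (s : seq 'I_n) i := x i * \prod_(j <- s) b j ^ v j i.
have main s : fixed_large (yof s) /\
    linked S (pt (iota \o rho) (fun i => iota (x i) * eps ^ a i))
      (pt (iota \o rho) (fun i => iota (yof s i) * eps ^ a i)).
  elim: s => [|j s [ys slnk]].
    have -> : yof [::] = x by apply/funext => i; rewrite /yof big_nil mulr1.
    by split; [split|move=> ? ?].
  have -> : yof (j :: s) = fun i => yof s i * b j ^ v j i.
    by apply/funext => i; rewrite /yof big_cons mulrCA mulrC.
  have [] := @fixed_large_move (yof s) (v j) (b j) ys (b0 j).
  - by move=> i xi; rewrite /v xi.
  - exact: bU.
  by move=> yjs jlnk; split=> //; exact: linked_trans jlnk.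
have [_] := main (index_enum 'I_n).
suff -> : yof (index_enum 'I_n) = xl by [].
apply/funext => i; rewrite /yof /xl; case: ifP => xi.
  by rewrite big1 ?mulr1 // => j _; rewrite /v xi expr0z.
under eq_bigr do rewrite /v xi /b.
rewrite -mon_sum //.
have -> : mon xs (fun i0 => \sum_j V j i0 * - invmx V i j) = (xs i)^-1.
  have sumE i' : \sum_j V j i' * - invmx V i j = - (i == i')%:R.
    have := congr1 (fun A : 'M_n => A i i') (mulVmx Vu); rewrite mxE [RHS]mxE => <-.
    by rewrite -sumrN; apply: eq_bigr => j _; rewrite mulrN mulrC.
  rewrite /mon (bigD1 i) //= sumE eqxx -invr_expz expr1z big1 ?mulr1 //.
  by move=> i' i'i; rewrite sumE eq_sym (negbTE i'i) oppr0 expr0z.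
by rewrite /xs xi mulfV // gt_eqF.
Qed.

(** All factors are now at least 1. Those that may exceed 1 carry the exponent [a i = 0], so they
    are coordinates and belong to the hull; their inverses are at most 1. Every factor is a unit,
    and the relations [h] hold automatically. *)
Lemma large_to_1_linked :
  linked S (pt (iota \o rho) (fun i => iota (xl i) * eps ^ a i))
    (pt (iota \o rho) (fun i => iota 1 * eps ^ a i)).
Proof.
pose yof (s : seq 'I_n) i := if i \in s then 1 else xl i.
have main s : linked S (pt (iota \o rho) (fun i => iota (xl i) * eps ^ a i))
      (pt (iota \o rho) (fun i => iota (yof s i) * eps ^ a i)).
  elim: s => [|i0 s slnk]; first by move=> ? ?.
  apply: (linked_trans slnk).
  pose v i : int := (i == i0)%:R.
  have ys1 i : 1 <= yof s i.
    by rewrite /yof /xl; case: ifP => // _; case: ifP => // /ltW.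
  have ys0 i : 0 < yof s i by exact: lt_le_trans (ys1 i).
  have yss i : x i <= 1 -> yof s i = 1.
    by rewrite leNgt /yof /xl => /negbTE ->; case: ifP.
  have -> : yof (i0 :: s) = fun i => yof s i * (yof s i0)^-1 ^ v i.
    apply/funext => i; rewrite {1}/yof in_cons /v; have [->|_] /= := eqVneq i i0.
      by rewrite expr1z mulfV // gt_eqF.
    by rewrite expr0z mulr1.
  apply: move_linked; first by rewrite invr_gt0.
  move=> E j e tau jE eI t0 tb; have [e0 _] := eI.
  have {tb} /andP[bt t1] : j (yof s i0)^-1 <= tau <= 1.
    case/orP: tb => // /andP[t1 tb]; have : j (yof s i0)^-1 <= 1.
      by rewrite -(rmorph1 j) jE invf_le1.
    by move=> b1; rewrite (le_trans tb b1) (le_trans b1 t1).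
  have y1 i : 1 <= j (yof s i) * tau ^ v i.
    rewrite /v; have [->|_] := eqVneq i i0.
      rewrite expr1z -ler_pdivrMl ?order_ext_gt0 //.
      by rewrite mulr1 -fmorphV.
    by rewrite expr0z mulr1 -(rmorph1 j) jE.
  have y0 i : 0 < j (yof s i) * tau ^ v i by exact: lt_le_trans (y1 i).
  apply: bounded_S => // [i|l].
    apply: convex_unitM; [exact: convK|exact: Kb_unit|].
    apply: convex_unitXz; first exact: convK.
    apply: (convex_unit_between (convK j) t0 (Kb_unit (yof s i0)^-1 jE)).
      by rewrite order_ext_gt0 // invr_gt0.
    by rewrite bt t1.
  set H := hull _; have convH : convex_subring H := hull_convex _.
  apply: mon_unit => // i _; split; last first.
    by apply: convex_le1; rewrite ?invr_gt0 // invf_le1.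
  have [x1|x1] := leP (x i) 1.
    apply: convex_le1 => //; rewrite yss // rmorph1 mul1r /v.
    by case: (i == i0); rewrite ?expr1z ?expr0z.
  have : H (j (yof s i) * tau ^ v i * e ^ a i).
    by apply: hull_X; rewrite mulr_gt0 // exprz_gt0.
  by rewrite a_big // expr0z mulr1.
have := main (enum 'I_n).
suff -> : yof (enum 'I_n) = fun=> 1 by [].
by apply/funext => i; rewrite /yof mem_enum.
Qed.

Lemma contraction_linked :
  linked S (pt rho x) (pt (iota \o rho) (fun i => eps ^ a i)).
Proof.
apply: (linked_trans shrink_linked); apply: (linked_trans small_to_1_linked).
have -> : (fun i => eps ^ a i) = fun i => iota 1 * eps ^ a i.
  by apply/funext => i; rewrite rmorph1 mul1r.
exact: large_to_1_linked.
Qed.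

Lemma contraction_S : S (pt (iota \o rho) (fun i => eps ^ a i)).
Proof.
have := @bounded_S L iota eps (fun=> 1) iotaE epsI (fun=> ltr01).
have -> : (fun i => 1 * eps ^ a i) = fun i => eps ^ a i.
  by apply/funext => i; rewrite mul1r.
apply=> [i|l]; first by apply: convex_unit1; exact: convK.
have convH := hull_convex (mmap (iota \o rho) (fun i => eps ^ a i) : {rmorphism _ -> _}).
by apply: mon_unit => // i _; exact: convex_unit1.
Qed.

End Infinitesimal.
End Contraction.
End Moves.

(** * Coordinates of an arbitrary point, and assembly of the paths *)

Lemma mmap_residue (R : comNzRingType) (n : nat) (d : sper {mpoly R[n]}) f :
  mmap (residue d \o @mpolyC n R) (fun i => residue d 'X_i) f = residue d f.
Proof.
elim/mpoly_closed: f => [c|i|f g|f g].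
- by rewrite mmapC.
- by rewrite mmapX mmap1U.
- by rewrite !rmorphD /= => -> ->.
- by rewrite !rmorphM /= => -> ->.
Qed.

Lemma pt_residue (R : comNzRingType) (n : nat) (d : sper {mpoly R[n]}) :
  same_signs d (pt (residue d \o @mpolyC n R) (fun i => residue d 'X_i)).
Proof.
move=> f; apply: etrans (esym (residue_gt0 d f)) _; apply: esym.
apply: etrans (pt_gt0 _ _ _) _.
exact: (congr1 (fun y => 0 < y) (mmap_residue d f)).
Qed.

Theorem theorem1p1 (R : rcfType) (n q u : nat) (q_gt0 : (0 < q)%N)
    (u_gt0 : (0 < u)%N)
    (omega : 'I_n -> 'I_q -> rat) (theta : 'I_n -> 'I_u -> rat) :
  connected [set delta : sper {mpoly R[n]} |
    (forall i : 'I_n, 0 < sper_eval delta 'X_i) /\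
    exists g : 'I_n -> val_group (sper_ring delta),
      [/\ forall i : 'I_n, sper_nu delta 'X_i = Some (g i),
          forall j : 'I_q, tensQ_gt0 (\sum_(i < n) tens (g i) (omega i j)) &
          forall l : 'I_u, \sum_(i < n) tens (g i) (theta i l) = 0]].
Proof.
have [N [k [N0 kE]]] := common_denominator (fun s : 'I_n * 'I_q + 'I_n * 'I_u =>
  match s with inl p => omega p.1 p.2 | inr p => theta p.1 p.2 end).
pose m (j : 'I_q) (i : 'I_n) := k (inl (i, j)).
pose h (l : 'I_u) (i : 'I_n) := k (inr (i, l)).
have omegaE i j : N%:R * omega i j = (m j i)%:~R by rewrite -(kE (inl (i, j))).
have thetaE i l : N%:R * theta i l = (h l i)%:~R by rewrite -(kE (inr (i, l))).
set S := (X in connected X).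
have S_residue d : S d <-> valuation_conditions m h (residue d).
  exact: (valuation_conditions_residue N0 omegaE thetaE).
clearbody S.
have S_pt (E : realFieldType) (rho : {rmorphism R -> E}) (x : 'I_n -> E) :
    S (pt rho x) <-> [/\ forall i, 0 < x i,
      forall j, ~ hull (mmap rho x) (mon x (m j))^-1 &
      forall l, convex_unit (hull (mmap rho x)) (mon x (h l))].
  have sgn f : (0 < residue (pt rho x) f) = (0 < mmap rho x f).
    by rewrite residue_gt0 pt_gt0.
  have mX : (fun i => mmap rho x 'X_i) = x.
    by apply/funext => i; rewrite mmapX mmap1U.
  have conditionsE : valuation_conditions m h (mmap rho x) <-> [/\ forall i, 0 < x i,
      forall j, ~ hull (mmap rho x) (mon x (m j))^-1 &
      forall l, convex_unit (hull (mmap rho x)) (mon x (h l))].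
    rewrite /valuation_conditions mX; split=> -[x0 mS hS]; split=> // i.
      by rewrite -[x]mX.
    by have := x0 i; rewrite -[x in x i]mX.
  rewrite S_residue -conditionsE; split; first exact: valuation_conditions_signs.
  by apply: valuation_conditions_signs => f; rewrite sgn.
have contract (F : realFieldType) (r : {rmorphism R -> F}) (x : 'I_n -> F) :
    S (pt r x) -> exists (K : realFieldType) (rho : {rmorphism R -> K})
    (eps : K) (a : 'I_n -> int),
    [/\ infinitesimal rho eps, forall i, 0 <= a i,
        (forall j, 0 < \sum_i a i * m j i) /\ forall l, \sum_i a i * h l i = 0,
        S (pt rho (fun i => eps ^ a i)) &
        linked S (pt r x) (pt rho (fun i => eps ^ a i))].
  move=> Sx; have [x0 mx hx] := (S_pt _ _ _).1 Sx.
  have [a [a0 a_big a_m a_h]] := direction (hull_convex _) x0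
    (fun i => hull_X r (x0 i)) mx hx.
  have [K [iota [eps [iotaE epsI]]]] := infinitesimal_ext F.
  exists K, (iota \o r), eps, a; split; [|exact: a0|by split| |].
  - exact: infinitesimal_sub (rcf_order_ext r) epsI.
  - exact: (contraction_S S_pt r a0 a_m a_h iotaE epsI).
  - exact: (contraction_linked S_pt Sx a0 a_big a_m a_h iotaE epsI).
have S_signs d d' : same_signs d d' -> S d -> S d'.
  move=> dd' /S_residue Sd; apply/S_residue; move: Sd; apply: valuation_conditions_signs => f.
  exact: etrans (residue_gt0 d f) (etrans (dd' f) (esym (residue_gt0 _ f))).
have contract_sper d : S d -> exists (K : realFieldType) (rho : {rmorphism R -> K})
    (eps : K) (a : 'I_n -> int),
    [/\ infinitesimal rho eps, forall i, 0 <= a i,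
        (forall j, 0 < \sum_i a i * m j i) /\ forall l, \sum_i a i * h l i = 0,
        S (pt rho (fun i => eps ^ a i)) &
        linked S d (pt rho (fun i => eps ^ a i))].
  move=> Sd; have d_pt := pt_residue d.
  have [K [rho [eps [a [epsI a0 amh Sa da]]]]] := contract _ _ _ (S_signs _ _ d_pt Sd).
  exists K, rho, eps, a; split; [exact: epsI|exact: a0|exact: amh|exact: Sa|].
  exact: linked_trans (same_signs_linked d_pt) da.
apply: linked_connected => d d' Sd Sd'.
have [K [rho [eps [a [epsI a0 [a_m a_h] Sa da]]]]] := contract_sper d Sd.
have [K' [rho' [eps' [a' [epsI' a'0 [a'_m a'_h] Sa' da']]]]] := contract_sper d' Sd'.
have [L [iota [eta [iotaE etaI]]]] := infinitesimal_ext K.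
(* The second contraction starts from powers of [eps], none of which exceeds 1; hence the exponents
   [a'] found for the other point are admissible. *)
have a'_big i : 1 < eps ^ a i -> a' i = 0.
  suff e1 : eps ^ a i <= 1 by move=> /(le_lt_trans e1); rewrite ltxx.
  have [e0 _] := epsI; have := infinitesimal_lt1 epsI.
  by case: (a i) (a0 i) => // p _ e1; rewrite -exprnP exprn_ile1 // ltW.
apply: (linked_trans da).
apply: (linked_trans (contraction_linked S_pt Sa a'0 a'_big a'_m a'_h iotaE etaI)).
(* [eta] and [eps'] live in unrelated fields, but both are infinitesimal over [R] and carry the same
   exponents [a'], so the two points have the same signs. *)
apply: (@linked_trans _ _ _ (pt rho' (fun i => eps' ^ a' i))).
  apply: same_signs_linked; apply: infinitesimal_pt epsI'.
  exact: infinitesimal_sub (rcf_order_ext rho) etaI.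
exact: linked_sym Sd' Sa' da'.
Qed.
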